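(* Let $\mathcal{C}(\mathcal{Z})$ be the discrete cluster category associated to an admissible subset $\mathcal{Z}\subseteq S^1$ with $n\ge 2$ limit points. Let $(\mathcal{X},\mathcal{Y})$ be a t-structure on $\mathcal{C}(\mathcal{Z})$ with associated $\overline{\mathcal{Z}}$-decorated non-crossing partition $(\mathcal{P},\mathbf{x})$ (i.e. $\mathcal{X}=\mathcal{X}(\mathcal{P},\mathbf{x})$). Let $T=\{t,t'\}$ be an arc of $\mathcal{Z}$, viewed as an object of $\mathcal{C}(\mathcal{Z})$. Then the approximation triangle of $T$ with respect to $(\mathcal{X},\mathcal{Y})$ is of the form $$Z\to T\to W\to\Sigma Z,$$ where $Z$ is the direct sum of all arcs from $T|_{\mathcal{X}}$ and $W$ is the direct sum of all arcs from $T|_{\mathcal{Y}}$, with $T|_{\mathcal{X}}$ and $T|_{\mathcal{Y}}$ the sets of arcs defined in the context.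
   Context: **Combinatorial setting.** $\mathbb{K}$ is a field. $S^1$ is the unit circle with anti-clockwise cyclic order: for pairwise distinct $x,y,z\in S^1$, $x<y<z$ means that going anti-clockwise one meets first $x$, then $y$, then $z$; for $m\ge 3$, $x_1<\dots<x_m$ means $x_i<x_{i+1}<x_{i+2}$ for all $i$ (indices modulo $m$). $\mathcal{Z}\subseteq S^1$ is admissible: discrete, infinite, with set of limit points $L(\mathcal{Z})=\overline{\mathcal{Z}}\setminus\mathcal{Z}$ ($\overline{\mathcal{Z}}$ the topological closure) finite of cardinality $n$ (here $n\geq 2$), every limit point being a two-sided limit point. The limit points are $a_1<\dots<a_n$, indices modulo $n$ (so $a_{n+1}=a_1$). For $a,b\in\overline{\mathcal{Z}}$, $(a,b)=\{c\in\overline{\mathcal{Z}}\mid a<c<b\}$, and $[a,b],[a,b),(a,b]$ are defined analogously as subsets of $\overline{\mathcal{Z}}$; $(a,a]=\varnothing$. Each $z\in\mathcal{Z}$ has an immediate successor $z^+$ and predecessor $z^-$ in $\mathcal{Z}$ (anti-clockwise, resp. clockwise neighbour). An arc of $\mathcal{Z}$ is a 2-element subset $\{z_0,z_1\}\subseteq\mathcal{Z}$ with $z_1\notin\{z_0^-,z_0,z_0^+\}$; a pair with $z_1\in\{z_0^-,z_0,z_0^+\}$ is called trivial. Arcs $\{y_0,y_1\},\{y_0',y_1'\}$ cross if $y_0<y_0'<y_1<y_1'$ or $y_0<y_1'<y_1<y_0'$. **The category.** $\mathcal{C}(\mathcal{Z})$ is the discrete cluster category of Igusa–Todorov: a $\mathbb{K}$-linear,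 2-Calabi–Yau, Krull–Schmidt triangulated category with suspension $\Sigma$ whose non-zero indecomposable objects correspond to arcs of $\mathcal{Z}$ (same notation for arc and object), with: - $\Sigma\{y_0,y_1\}=\{y_0^-,y_1^-\}$; - $\mathrm{Hom}(\{y_0,y_1\},\Sigma\{y_0',y_1'\})=\mathbb{K}$ if the arcs $\{y_0,y_1\}$ and $\{y'_0,y'_1\}$ cross, and $0$ otherwise; - a non-zero morphism $\{y_0,y_1\}\to\{y_0',y_1'\}$ with $y_0<y_0'^+<y_1<y_1'^+$ factors through an indecomposable $S$ iff $S=\{s_0,s_1\}$ with $y_0\le s_0\le y_0'$ and $y_1\le s_1\le y_1'$; - if $y_0<y_0'<y_1<y_1'$, every non-zero $f:\{y_0,y_1\}\to\Sigma\{y_0',y_1'\}$ sits in a triangle $\{y_0',y_1'\}\to X\oplus Z\to\{y_0,y_1\}\xrightarrow{f}\Sigma\{y_0',y_1'\}$ with $X=\{y_0,y_0'\}$, $Z=\{y_1,y_1'\}$ (read as $0$ when not an arc); the components of the first two maps to and from $X$, $Z$ are non-zero when the corresponding objects are non-zero. All subcategories are full and closed under direct sums and summands; $\mathrm{add}(\mathcal{Y})$ is the smallest such subcategory containing the set of arcs $\mathcal{Y}$. **t-structures.** A torsion pair in a triangulated category $\mathcal{T}$ is a pair $(\mathcal{X},\mathcal{Y})$ of subcategories closed under direct summands with $\mathrm{Hom}(X,Y)=0$ for $X\in\mathcal{X},Y\in\mathcal{Y}$ and such that every $T\in\mathcal{T}$ has a distinguished triangle $X\to T\to Y\to\Sigma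 X$ with $X\in\mathcal{X},Y\in\mathcal{Y}$. A t-structure is a torsion pair with $\Sigma\mathcal{X}\subseteq\mathcal{X}$; $\mathcal{X}$ is its aisle, $\mathcal{Y}=\mathcal{X}^\perp$ its coaisle. For a t-structure the triangle above is unique up to isomorphism and is called the approximation triangle of $T$. **Decorated partitions.** A non-crossing partition $\mathcal{P}=\{B_m\mid m\in I\}$ of $[n]=\{1,\dots,n\}$ is a partition of $[n]$ into non-empty blocks such that whenever $i<k<j<l$ with $i,j\in B_{m_1}$, $k,l\in B_{m_2}$, then $m_1=m_2$. $i$ is a singleton of $\mathcal{P}$ if $\{i\}\in\mathcal{P}$; $i$ is an adjacency of $\mathcal{P}$ if $i$ and $i+1$ (cyclically modulo $n$) are in the same block. A $\overline{\mathcal{Z}}$-decoration of $\mathcal{P}$ is a tuple $\mathbf{x}=(x_1,\ldots,x_n)$ with $x_i\in[a_i,a_{i+1})$ if $i$ is a singleton, $x_i\in(a_i,a_{i+1}]$ if $i$ is an adjacency, and $x_i\in(a_i,a_{i+1})$ otherwise. Set $$\mathcal{X}(\mathcal{P},\mathbf{x})=\mathrm{add}\{\{y_0,y_1\}\text{ arc of }\mathcal{Z}\mid y_0,y_1\in\textstyle\bigcup_{i\in B}(a_i,x_i]\text{ for some }B\in\mathcal{P}\}.$$ The assignment $(\mathcal{P},\mathbf{x})\mapsto\mathcal{X}(\mathcal{P},\mathbf{x})$ is a bijection from $\overline{\mathcal{Z}}$-decorated non-crossing partitions of $[n]$ to aisles of t-structures in $\mathcal{C}(\mathcal{Z})$.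 **The sets $T|_{\mathcal{X}}$ and $T|_{\mathcal{Y}}$.** For $u\in\mathcal{Z}$ and a block $B\in\mathcal{P}$ set $u_B=\max_{[u^+,u]}\{z\in\bigcup_{i\in B}(a_i,x_i]\}$, i.e. the first point lying in one of the intervals $(a_i,x_i]$, $i\in B$, met when walking from $u$ (inclusive) in clockwise direction. Say that $T=\{t,t'\}$ and $B$ cross if there is an arc $\{v_0,v_1\}$ with $v_0,v_1\in\bigcup_{i\in B}(a_i,x_i]$ crossing $T$. Let $B_1,\dots,B_l$ be the mutually distinct blocks of $\mathcal{P}$ crossing $T$, and set $z_i=t_{B_i}$, $z_i'=t'_{B_i}$. The numbering is chosen such that $t\ge z_1>z_2>\dots>z_l>t'$ in the interval from $t'$ anti-clockwise to $t$ (so going clockwise from $t$ to $t'$ one meets $z_1,z_2,\dots,z_l$ in this order); this is equivalent to $t'\ge z_l'>\dots>z_2'>z_1'>t$ in the interval from $t$ anti-clockwise to $t'$. Put $$T|_{\mathcal{X}}=\{\text{non-trivial arcs }\{z_i',z_i\}\text{ for }1\le i\le l\},$$ $$T|_{\mathcal{Y}}=\{\text{non-trivial arcs }\{t,z_1^-\},\ \{z_l'^{-},t'\},\ \{z_i'^{-},z_{i+1}^-\}\text{ for }1\le i\le l-1\}.$$ If no block crosses $T$ ($l=0$), then $T|_{\mathcal{X}}=\varnothing$ and $T|_{\mathcal{Y}}=\{T\}$. *)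

(* Defs.v *)
From HB Require Import structures.
From mathcomp Require Import all_boot all_order all_algebra.
From mathcomp Require Import all_classical all_reals all_analysis.

Set Implicit Arguments.
Unset Strict Implicit.
Unset Printing Implicit Defensive.

Import Order.TTheory GRing.Theory Num.Theory.
Import numFieldNormedType.Exports.

Local Open Scope classical_set_scope.
Local Open Scope ring_scope.

Record linear_category (K : fieldType) := LinearCategory {
  cat_obj :> Type;
  mor : cat_obj -> cat_obj -> lmodType K;
  idm : forall A, mor A A;
  cmp : forall A B D, mor B D -> mor A B -> mor A D;
  cmp1m : forall A B (f : mor A B), cmp (idm B) f = f;
  cmpm1 : forall A B (f : mor A B), cmp f (idm A) = f;
  cmpA : forall A B D E (h : mor D E) (g : mor B D) (f : mor A B),
    cmp h (cmp g f) = cmp (cmp h g) f;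
  cmp_linearl : forall A B D (f : mor A B),
    linear (fun g : mor B D => cmp g f);
  cmp_linearr : forall A B D (g : mor B D),
    linear (fun f : mor A B => cmp g f)
}.

Arguments mor {K l} A B.
Arguments idm {K l} A.
Arguments cmp {K l A B D} g f.

Declare Scope cat_scope.
Delimit Scope cat_scope with cat.
Notation "g \oc f" := (cmp g f)
  (at level 40, left associativity, format "g  \oc  f") : cat_scope.
Local Open Scope cat_scope.

Definition is_iso (K : fieldType) (C : linear_category K) (A B : C)
    (f : mor A B) : Prop :=
  exists g : mor B A, g \oc f = idm A /\ f \oc g = idm B.

Definition isomorphic (K : fieldType) (C : linear_category K) (A B : C) : Prop :=
  exists f : mor A B, is_iso f.

Definition is_zero (K : fieldType) (C : linear_category K) (A : C) : Prop :=
  idm A = 0.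

Definition is_biproduct (K : fieldType) (C : linear_category K) (A B S : C)
    (iA : mor A S) (iB : mor B S) (pA : mor S A) (pB : mor S B) : Prop :=
  [/\ pA \oc iA = idm A, pB \oc iB = idm B, pA \oc iB = 0, pB \oc iA = 0
    & iA \oc pA + iB \oc pB = idm S].

Definition is_direct_sum (K : fieldType) (C : linear_category K) (m : nat)
    (F : 'I_m -> C) (S : C) : Prop :=
  exists (i : forall k, mor (F k) S) (p : forall k, mor S (F k)),
    [/\ forall k, p k \oc i k = idm (F k),
        forall k l, k != l -> p k \oc i l = 0
      & \sum_(k < m) i k \oc p k = idm S].

Record triangulated_category (K : fieldType) := TriangulatedCategory {
  tri_cat :> linear_category K;
  zero_object : exists O : tri_cat, is_zero O;
  biproducts : forall A B : tri_cat,
    exists (S : tri_cat) (iA : mor A S) (iB : mor B S)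
      (pA : mor S A) (pB : mor S B), is_biproduct iA iB pA pB;
  (* The suspension is a K-linear autoequivalence. *)
  susp : tri_cat -> tri_cat;
  suspm : forall A B : tri_cat, mor A B -> mor (susp A) (susp B);
  suspm1 : forall A, suspm (idm A) = idm (susp A);
  suspmM : forall A B D (g : mor B D) (f : mor A B),
    suspm (g \oc f) = suspm g \oc suspm f;
  suspm_linear : forall A B, linear (@suspm A B);
  suspm_bij : forall A B, bijective (@suspm A B);
  susp_esssurj : forall B, exists A, isomorphic (susp A) B;
  distinguished : forall A B D : tri_cat,
    mor A B -> mor B D -> mor D (susp A) -> Prop;
  tr1_iso : forall A B D A' B' D'
    (f : mor A B) (g : mor B D) (h : mor D (susp A))
    (f' : mor A' B') (g' : mor B' D') (h' : mor D' (susp A'))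
    (u : mor A A') (v : mor B B') (w : mor D D'),
    distinguished f g h -> is_iso u -> is_iso v -> is_iso w ->
    v \oc f = f' \oc u -> w \oc g = g' \oc v ->
    suspm u \oc h = h' \oc w ->
    distinguished f' g' h';
  tr1_id : forall A O : tri_cat, is_zero O ->
    @distinguished A A O (idm A) 0 0;
  tr1_cone : forall (A B : tri_cat) (f : mor A B),
    exists (D : tri_cat) (g : mor B D) (h : mor D (susp A)),
      distinguished f g h;
  tr2 : forall (A B D : tri_cat)
    (f : mor A B) (g : mor B D) (h : mor D (susp A)),
    distinguished f g h <-> distinguished g h (- suspm f);
  tr3 : forall A B D A' B' D'
    (f : mor A B) (g : mor B D) (h : mor D (susp A))
    (f' : mor A' B') (g' : mor B' D') (h' : mor D' (susp A'))
    (u : mor A A') (v : mor B B'),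
    distinguished f g h -> distinguished f' g' h' ->
    v \oc f = f' \oc u ->
    exists w : mor D D', w \oc g = g' \oc v /\ suspm u \oc h = h' \oc w;
  tr4 : forall A B D D' B' A'
    (f : mor A B) (f1 : mor B D') (f2 : mor D' (susp A))
    (g : mor B D) (g1 : mor D A') (g2 : mor A' (susp B))
    (h1 : mor D B') (h2 : mor B' (susp A)),
    distinguished f f1 f2 -> distinguished g g1 g2 ->
    distinguished (g \oc f) h1 h2 ->
    exists (u : mor D' B') (v : mor B' A'),
      [/\ distinguished u v (suspm f1 \oc g2),
          u \oc f1 = h1 \oc g, h2 \oc u = f2, v \oc h1 = g1
        & g2 \oc v = suspm f \oc h2]
}.

Arguments susp {K t} A.
Arguments suspm {K t A B} f.
Arguments distinguished {K t A B D} f g h.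

Definition hom_finite (K : fieldType) (C : linear_category K) : Prop :=
  forall A B : C, exists (m : nat) (e : 'I_m -> mor A B),
    forall f : mor A B, exists c : 'I_m -> K, f = \sum_(i < m) c i *: e i.

Definition local_endomorphisms (K : fieldType) (C : linear_category K) (A : C) :
    Prop :=
  ~ is_zero A /\ forall f : mor A A, is_iso f \/ is_iso (idm A - f).

Definition krull_schmidt (K : fieldType) (C : linear_category K) : Prop :=
  forall S : C, exists (m : nat) (F : 'I_m -> C),
    (forall k, local_endomorphisms (F k)) /\ is_direct_sum F S.

Definition indecomposable (K : fieldType) (C : linear_category K) (S : C) :
    Prop :=
  ~ is_zero S /\
  forall (A B : C) (iA : mor A S) (iB : mor B S) (pA : mor S A) (pB : mor S B),
    is_biproduct iA iB pA pB -> is_zero A \/ is_zero B.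

(* The square of the suspension is a Serre functor: the pairing
   [b A B : Hom(A, B) x Hom(B, Sigma^2 A) -> K] encodes an isomorphism from
   Hom(A, B) to the K-dual of Hom(B, Sigma^2 A), natural in A and B.          *)
Definition calabi_yau2 (K : fieldType) (C : triangulated_category K) : Prop :=
  hom_finite C /\
  exists b : forall A B : C, mor A B -> mor B (susp (susp A)) -> K,
    [/\ forall A B (g : mor B (susp (susp A))), scalar (fun f => b A B f g),
        forall A B (f : mor A B), scalar (b A B f),
        forall A B (l : {scalar mor B (susp (susp A))}),
          exists! f : mor A B, forall g, l g = b A B f g,
        forall A' A B (u : mor A' A) (f : mor A B) (g : mor B (susp (susp A'))),
          b A' B (f \oc u) g = b A B f (suspm (suspm u) \oc g)
      & forall A B B' (v : mor B B') (f : mor A B)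
          (g : mor B' (susp (susp A))),
          b A B' (v \oc f) g = b A B f (g \oc v)].

(* Full subcategories are given by their sets of objects. A subcategory with
   this property is closed under isomorphism: if S is isomorphic to A, then S
   is a biproduct of A and a zero object.                                     *)
Definition closed_subcategory (K : fieldType) (C : linear_category K)
    (X : set C) : Prop :=
  (forall O : C, is_zero O -> X O) /\
  forall (A B S : C) (iA : mor A S) (iB : mor B S) (pA : mor S A)
    (pB : mor S B), is_biproduct iA iB pA pB -> (X S <-> X A /\ X B).

Definition add_generated (K : fieldType) (C : linear_category K)
    (G : set C) : set C :=
  [set S | forall X : set C, closed_subcategory X -> G `<=` X -> X S].

Definition approximation_triangle (K : fieldType) (C : triangulated_category K)
    (X Y : set C) (A T B : C)
    (f : mor A T) (g : mor T B) (h : mor B (susp A)) : Prop :=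
  [/\ X A, Y B & distinguished f g h].

Definition torsion_pair (K : fieldType) (C : triangulated_category K)
    (X Y : set C) : Prop :=
  [/\ closed_subcategory X, closed_subcategory Y,
      forall (A B : C) (f : mor A B), X A -> Y B -> f = 0
    & forall T : C, exists (A B : C) (f : mor A T) (g : mor T B)
        (h : mor B (susp A)), approximation_triangle X Y f g h].

Definition t_structure (K : fieldType) (C : triangulated_category K)
    (X Y : set C) : Prop :=
  torsion_pair X Y /\ forall A : C, X A -> X (susp A).

Definition circle_point (R : realType) (u : R) : R * R := (cos u, sin u).

Definition unit_circle (R : realType) : set (R * R) :=
  [set p | p.1 ^+ 2 + p.2 ^+ 2 = 1].

(* Walking anti-clockwise once around from x, one meets y and then z. *)
Definition cyc3 (R : realType) (x y z : R * R) : Prop :=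
  exists u s t : R, 0 < s < t /\ t < 2 * pi /\
    [/\ x = circle_point u, y = circle_point (u + s)
      & z = circle_point (u + t)].

Definition cyc4 (R : realType) (x y z w : R * R) : Prop :=
  [/\ cyc3 x y z, cyc3 y z w, cyc3 z w x & cyc3 w x y].

Definition Ioo (R : realType) (Z : set (R * R)) (a b : R * R) : set (R * R) :=
  [set c | closure Z c /\ cyc3 a c b].
Definition Icc (R : realType) (Z : set (R * R)) (a b : R * R) : set (R * R) :=
  [set c | closure Z c /\ (c = a \/ c = b \/ cyc3 a c b)].
Definition Ico (R : realType) (Z : set (R * R)) (a b : R * R) : set (R * R) :=
  [set c | closure Z c /\ a <> b /\ (c = a \/ cyc3 a c b)].
Definition Ioc (R : realType) (Z : set (R * R)) (a b : R * R) : set (R * R) :=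
  [set c | closure Z c /\ a <> b /\ (c = b \/ cyc3 a c b)].

(* The limit points of Z are listed in anti-clockwise order by [a]. The order
   condition is imposed on all triples: for five or more points, consecutive
   triples do not prevent the list from winding several times around.         *)
Definition admissible (R : realType) (n : nat) (Z : set (R * R))
    (a : 'I_n -> R * R) : Prop :=
  [/\ Z `<=` @unit_circle R /\ Z `<=` isolated Z,
      infinite_set Z,
      injective a /\ range a = closure Z `\` Z,
      forall i j k : 'I_n, (i < j < k)%N -> cyc3 (a i) (a j) (a k)
    & forall (i : 'I_n) (p : R * R), unit_circle p -> p <> a i ->
        closure [set z | Z z /\ cyc3 p z (a i)] (a i) /\
        closure [set z | Z z /\ cyc3 (a i) z p] (a i)].

Definition succ_pt (R : realType) (Z : set (R * R)) (z : R * R) : R * R :=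
  xget z [set w | [/\ Z w, w <> z & forall v, Z v -> ~ cyc3 z v w]].

Definition pred_pt (R : realType) (Z : set (R * R)) (z : R * R) : R * R :=
  xget z [set w | [/\ Z w, w <> z & forall v, Z v -> ~ cyc3 w v z]].

Definition nontrivial_pair (R : realType) (Z : set (R * R)) (y0 y1 : R * R) :
    Prop :=
  [/\ Z y0, Z y1 & ~ [set pred_pt Z y0; y0; succ_pt Z y0] y1].

Definition is_arc (R : realType) (Z : set (R * R)) (A : set (R * R)) : Prop :=
  exists y0 y1, nontrivial_pair Z y0 y1 /\ A = [set y0; y1].

Definition cross (R : realType) (y0 y1 y0' y1' : R * R) : Prop :=
  cyc4 y0 y0' y1 y1' \/ cyc4 y0 y1' y1 y0'.

(* [ob A] is the object of the arc A; it is total on sets of points, and zero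
   on those that are not arcs.                                                *)
Record discrete_cluster_category (R : realType) (K : fieldType)
    (Z : set (R * R)) (C : triangulated_category K)
    (ob : set (R * R) -> C) : Prop := DiscreteClusterCategory {
  dcc_calabi_yau : calabi_yau2 C;
  dcc_krull_schmidt : krull_schmidt C;
  dcc_trivial : forall A, ~ is_arc Z A -> is_zero (ob A);
  dcc_indecomposable : forall A, is_arc Z A -> indecomposable (ob A);
  dcc_inj : forall A B, is_arc Z A -> is_arc Z B ->
    isomorphic (ob A) (ob B) -> A = B;
  dcc_surj : forall S : C, indecomposable S ->
    exists2 A, is_arc Z A & isomorphic S (ob A);
  dcc_susp : forall y0 y1, is_arc Z [set y0; y1] ->
    isomorphic (susp (ob [set y0; y1])) (ob [set pred_pt Z y0; pred_pt Z y1]);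
  dcc_hom_cross : forall y0 y1 y0' y1',
    is_arc Z [set y0; y1] -> is_arc Z [set y0'; y1'] -> cross y0 y1 y0' y1' ->
    exists l : {scalar mor (ob [set y0; y1]) (susp (ob [set y0'; y1']))},
      bijective l;
  dcc_hom_noncross : forall y0 y1 y0' y1',
    is_arc Z [set y0; y1] -> is_arc Z [set y0'; y1'] -> ~ cross y0 y1 y0' y1' ->
    forall f : mor (ob [set y0; y1]) (susp (ob [set y0'; y1'])), f = 0;
  dcc_factor : forall y0 y1 y0' y1',
    is_arc Z [set y0; y1] -> is_arc Z [set y0'; y1'] ->
    cyc4 y0 (succ_pt Z y0') y1 (succ_pt Z y1') ->
    forall f : mor (ob [set y0; y1]) (ob [set y0'; y1']), f <> 0 ->
    forall S, is_arc Z S ->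
      ((exists (g : mor (ob [set y0; y1]) (ob S))
               (h : mor (ob S) (ob [set y0'; y1'])), f = h \oc g)
       <->
       exists s0 s1, [/\ S = [set s0; s1], Icc Z y0 y0' s0 & Icc Z y1 y1' s1]);
  dcc_triangle : forall y0 y1 y0' y1',
    is_arc Z [set y0; y1] -> is_arc Z [set y0'; y1'] -> cyc4 y0 y0' y1 y1' ->
    forall f : mor (ob [set y0; y1]) (susp (ob [set y0'; y1'])), f <> 0 ->
    exists (E : C)
      (i0 : mor (ob [set y0; y0']) E) (i1 : mor (ob [set y1; y1']) E)
      (p0 : mor E (ob [set y0; y0'])) (p1 : mor E (ob [set y1; y1']))
      (u : mor (ob [set y0'; y1']) E) (v : mor E (ob [set y0; y1])),
      [/\ is_biproduct i0 i1 p0 p1,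
          distinguished u v f,
          is_arc Z [set y0; y0'] -> p0 \oc u <> 0 /\ v \oc i0 <> 0
        & is_arc Z [set y1; y1'] -> p1 \oc u <> 0 /\ v \oc i1 <> 0]
}.

(* [S] is the direct sum of the (finitely many) arcs of the set [A]. *)
Definition sum_of_arcs (R : realType) (K : fieldType)
    (C : triangulated_category K) (ob : set (R * R) -> C)
    (A : set (set (R * R))) (S : C) : Prop :=
  exists (m : nat) (s : 'I_m -> set (R * R)),
    [/\ injective s, range s = A & is_direct_sum (fun k => ob (s k)) S].

Definition noncrossing_partition (n : nat) (P : {set {set 'I_n}}) : Prop :=
  finset.partition P [set: 'I_n]%SET /\
  forall B B' : {set 'I_n}, B \in P -> B' \in P ->
  forall i k j l : 'I_n, (i < k)%N -> (k < j)%N -> (j < l)%N ->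
    i \in B -> j \in B -> k \in B' -> l \in B' -> B = B'.

Definition singleton (n : nat) (P : {set {set 'I_n}}) (i : 'I_n) : Prop :=
  [set i]%SET \in P.

Definition adjacency (n : nat) (P : {set {set 'I_n}}) (i : 'I_n) : Prop :=
  exists B : {set 'I_n}, [/\ B \in P, i \in B & ordS i \in B].

Definition decoration (R : realType) (n : nat) (Z : set (R * R))
    (a : 'I_n -> R * R) (P : {set {set 'I_n}}) (x : 'I_n -> R * R) : Prop :=
  forall i : 'I_n,
    [/\ singleton P i -> Ico Z (a i) (a (ordS i)) (x i),
        adjacency P i -> Ioc Z (a i) (a (ordS i)) (x i)
      & ~ singleton P i -> ~ adjacency P i -> Ioo Z (a i) (a (ordS i)) (x i)].

Definition block_points (R : realType) (n : nat) (Z : set (R * R))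
    (a x : 'I_n -> R * R) (B : {set 'I_n}) : set (R * R) :=
  [set p | exists2 i, i \in B & Ioc Z (a i) (x i) p].

Definition aisle_of (R : realType) (K : fieldType) (n : nat) (Z : set (R * R))
    (C : triangulated_category K) (ob : set (R * R) -> C)
    (a : 'I_n -> R * R) (P : {set {set 'I_n}}) (x : 'I_n -> R * R) : set C :=
  add_generated [set S | exists (B : {set 'I_n}) (y0 y1 : R * R),
    [/\ B \in P, is_arc Z [set y0; y1], block_points Z a x B y0,
        block_points Z a x B y1 & S = ob [set y0; y1]]].

(* [block_max Z a x u B] is the maximum of [block_points Z a x B] for the linear
   order on [u^+, u] in which q is below p when q lies in [u^+, p].           *)
Definition block_max (R : realType) (n : nat) (Z : set (R * R))
    (a x : 'I_n -> R * R) (u : R * R) (B : {set 'I_n}) : R * R :=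
  xget u [set p | block_points Z a x B p /\
                  forall q, block_points Z a x B q -> Icc Z (succ_pt Z u) p q].

Definition block_crosses (R : realType) (n : nat) (Z : set (R * R))
    (a x : 'I_n -> R * R) (B : {set 'I_n}) (t t' : R * R) : Prop :=
  exists v0 v1, [/\ is_arc Z [set v0; v1], block_points Z a x B v0,
                    block_points Z a x B v1 & cross v0 v1 t t'].

(* [bs] lists without repetition the blocks B_1, ..., B_l crossing {t, t'}, in
   the order in which their points z_i are met going clockwise from t to t'.
   Indices into [bs] start from 0.                                            *)
Definition crossing_blocks (R : realType) (n : nat) (Z : set (R * R))
    (a : 'I_n -> R * R) (P : {set {set 'I_n}}) (x : 'I_n -> R * R)
    (t t' : R * R) (bs : seq {set 'I_n}) : Prop :=
  let z i := block_max Z a x t (nth finset.set0 bs i) in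
  [/\ uniq bs,
      forall B, B \in bs <-> B \in P /\ block_crosses Z a x B t t',
      forall i, (i < size bs)%N -> Ioc Z t' t (z i)
    & forall i, (i.+1 < size bs)%N -> cyc3 t' (z i.+1) (z i)].

Definition arcs_X (R : realType) (n : nat) (Z : set (R * R))
    (a x : 'I_n -> R * R) (t t' : R * R) (bs : seq {set 'I_n}) :
    set (set (R * R)) :=
  let z i := block_max Z a x t (nth finset.set0 bs i) in
  let z' i := block_max Z a x t' (nth finset.set0 bs i) in
  [set A | is_arc Z A /\ exists2 i, (i < size bs)%N & A = [set z' i; z i]].

Definition arcs_Y (R : realType) (n : nat) (Z : set (R * R))
    (a x : 'I_n -> R * R) (t t' : R * R) (bs : seq {set 'I_n}) :
    set (set (R * R)) :=
  let z i := block_max Z a x t (nth finset.set0 bs i) in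
  let z' i := block_max Z a x t' (nth finset.set0 bs i) in
  if size bs is l.+1 then
    [set A | is_arc Z A /\
       [\/ A = [set t; pred_pt Z (z 0)], A = [set pred_pt Z (z' l); t']
         | exists2 i, (i < l)%N & A = [set pred_pt Z (z' i); pred_pt Z (z i.+1)]]]
  else [set [set t; t']].

(* Main.v *)
(* For an approximation triangle M -> T -> W of a t-structure (X, Y), M represents
   the restriction of Hom(-, T) to X and W corepresents the restriction of
   Hom(T, -) to Y. So it suffices to see that the two direct sums of arcs have
   the same universal properties.
   An arc A with ends in a block B has a non-zero morphism to T iff it crosses
   the arc {t^+, t'^+}; then B is one of the blocks B_i crossing T, the morphism
   factors through {z_i', z_i}, and A has no non-zero morphisms to the other arcs
   of T|_X. By the Krull-Schmidt property, Y is generated by the arcs D in Y,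
   those such that no arc of a block crosses D^+. If T has a non-zero morphism
   to such a D, then D^+ crosses T between two consecutive chords {z_i', z_i},
   which determines the unique arc of T|_Y that it factors through. *)
Require Import Defs.
From mathcomp Require Import all_boot all_order all_algebra.
From mathcomp Require Import all_classical all_reals all_analysis.
From mathcomp Require Import lra zify.

Set Implicit Arguments.
Unset Strict Implicit.
Unset Printing Implicit Defensive.

Import Order.TTheory GRing.Theory Num.Theory.
Import numFieldNormedType.Exports.

Local Open Scope classical_set_scope.
Local Open Scope ring_scope.
Local Open Scope cat_scope.

(** * Direct sums and the functors they represent *)

(** Three facts about arcs carry the argument: Hom(A, D) is at most one-dimensional, it is non-zero
    iff A crosses D^+, and a non-zero morphism factors through the arcs of an explicit region. None
    of them says when a composite is non-zero. This gap is closed indirectly: if A maps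
    non-trivially to a summand F_k, the crossing rule gives a non-zero morphism from A to T; it
    factors through some summand, which can only be F_k, and since the Hom spaces involved are
    lines, the composite of A -> F_k with a fixed non-zero F_k -> T is non-zero too. The same works
    with the arrows reversed. What remains concerns the cyclic order of finitely many points. The
    degenerate positions are the difficulty: t may lie in a block, z_i may equal t, neighbouring
    points make pairs trivial, x_i may be a limit point, and a strict crossing of D^+ is a half-open
    condition on D. Hence such claims are decided by reflection. *)

Section LinearCategory.
Variables (K : fieldType) (C : linear_category K).
Implicit Types A B D S T : C.

Lemma cmpDl A B D (g g' : mor B D) (f : mor A B) :
  (g + g') \oc f = g \oc f + g' \oc f.
Proof. by have := cmp_linearl f 1 g g'; rewrite !scale1r. Qed.

Lemma cmpDr A B D (g : mor B D) (f f' : mor A B) :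
  g \oc (f + f') = g \oc f + g \oc f'.
Proof. by have := cmp_linearr g 1 f f'; rewrite !scale1r. Qed.

Lemma cmp0l A B D (f : mor A B) : (0 : mor B D) \oc f = 0.
Proof. by apply: (addrI (0 \oc f)); rewrite -cmpDl !addr0. Qed.

Lemma cmp0r A B D (g : mor B D) : g \oc (0 : mor A B) = 0.
Proof. by apply: (addrI (g \oc 0)); rewrite -cmpDr !addr0. Qed.

Lemma cmpZl A B D c (g : mor B D) (f : mor A B) :
  (c *: g) \oc f = c *: (g \oc f).
Proof. by have := cmp_linearl f c g 0; rewrite cmp0l !addr0. Qed.

Lemma cmpZr A B D c (g : mor B D) (f : mor A B) :
  g \oc (c *: f) = c *: (g \oc f).
Proof. by have := cmp_linearr g c f 0; rewrite cmp0r !addr0. Qed.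

Lemma cmpNl A B D (g : mor B D) (f : mor A B) : (- g) \oc f = - (g \oc f).
Proof. by rewrite -!scaleN1r cmpZl. Qed.

Lemma cmpNr A B D (g : mor B D) (f : mor A B) : g \oc (- f) = - (g \oc f).
Proof. by rewrite -!scaleN1r cmpZr. Qed.

Lemma cmpBl A B D (g g' : mor B D) (f : mor A B) :
  (g - g') \oc f = g \oc f - g' \oc f.
Proof. by rewrite cmpDl cmpNl. Qed.

Lemma cmpBr A B D (g : mor B D) (f f' : mor A B) :
  g \oc (f - f') = g \oc f - g \oc f'.
Proof. by rewrite cmpDr cmpNr. Qed.

Lemma cmp_suml A B D (I : Type) (r : seq I) (p : pred I) (g : I -> mor B D)
    (f : mor A B) :
  (\sum_(k <- r | p k) g k) \oc f = \sum_(k <- r | p k) (g k \oc f).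
Proof. by elim/big_ind2: _ => [|u u' v v' <- <-|//]; rewrite (cmp0l, cmpDl). Qed.

Lemma cmp_sumr A B D (I : Type) (r : seq I) (p : pred I) (g : mor B D)
    (f : I -> mor A B) :
  g \oc (\sum_(k <- r | p k) f k) = \sum_(k <- r | p k) (g \oc f k).
Proof. by elim/big_ind2: _ => [|u u' v v' <- <-|//]; rewrite (cmp0r, cmpDr). Qed.

Lemma is_zero_src A B (f : mor A B) : is_zero A -> f = 0.
Proof. by move=> A0; rewrite -[f]cmpm1 A0 cmp0r. Qed.

Lemma closed_subcategory_iso (X : set C) A B :
  closed_subcategory X -> (exists O : C, is_zero O) ->
  isomorphic A B -> X A -> X B.
Proof.
move=> [X0 Xsum] [z z0] [f [g [gf fg]]] XA.
apply/(Xsum A z B f 0 g 0); last by split=> //; exact: X0.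
by split; rewrite ?cmp0l ?cmp0r ?addr0 //; apply/esym.
Qed.

Lemma closed_add_generated (G : set C) : closed_subcategory (add_generated G).
Proof.
split=> [z z0 X Xc _|A B S iA iB pA pB S_biprod]; first exact: (proj1 Xc).
split=> [GS|[GA GB] X Xc GX]; last first.
  by apply/(proj2 Xc _ _ _ _ _ _ _ S_biprod); split; [exact: GA|exact: GB].
by split=> X Xc GX; have /(proj2 Xc _ _ _ _ _ _ _ S_biprod)[] := GS X Xc GX.
Qed.

Lemma sub_add_generated (G : set C) : G `<=` add_generated G.
Proof. by move=> A GA X _; exact. Qed.

Lemma is_direct_sum_iso m (F : 'I_m -> C) S S' :
  is_direct_sum F S -> isomorphic S S' -> is_direct_sum F S'.
Proof.
move=> [i [p [pi pi0 ip]]] [f [g [gf fg]]].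
exists (fun k => f \oc i k), (fun k => p k \oc g); split=> [k|k l kl|].
- by rewrite -cmpA (cmpA g) gf cmp1m pi.
- by rewrite -cmpA (cmpA g) gf cmp1m pi0.
under eq_bigr => k _ do rewrite -cmpA (cmpA (i k)).
by rewrite -cmp_sumr -cmp_suml ip cmp1m.
Qed.

Lemma direct_sum_unique m (F : 'I_m -> C) S S' :
  is_direct_sum F S -> is_direct_sum F S' -> isomorphic S S'.
Proof.
have comp S1 S2 (i1 : forall k, mor (F k) S1) (p1 : forall k, mor S1 (F k))
    (i2 : forall k, mor (F k) S2) (p2 : forall k, mor S2 (F k)) :
    (forall k, p2 k \oc i2 k = idm (F k)) ->
    (forall k l, k != l -> p2 k \oc i2 l = 0) ->
    \sum_(k < m) i1 k \oc p1 k = idm S1 ->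
    (\sum_k i1 k \oc p2 k) \oc (\sum_k i2 k \oc p1 k) = idm S1.
  move=> pi pi0 ip; rewrite cmp_suml -ip; apply: eq_bigr => k _.
  rewrite cmp_sumr (bigD1 k) //= big1 => [|l lk].
    by rewrite addr0 -cmpA (cmpA (p2 k)) pi cmp1m.
  by rewrite -cmpA (cmpA (p2 k)) pi0 ?cmp0l ?cmp0r // eq_sym.
move=> [i [p [pi pi0 ip]]] [i' [p' [pi' pi0' ip']]].
exists (\sum_k i' k \oc p k), (\sum_k i k \oc p' k).
by split; apply: comp.
Qed.

Definition additive_category := (exists O : C, is_zero O) /\
  forall A B : C, exists (S : C) (iA : mor A S) (iB : mor B S)
    (pA : mor S A) (pB : mor S B), is_biproduct iA iB pA pB.

End LinearCategory.

(** The inclusions and projections of a direct sum have types depending on the index, so adding one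
    summand needs a transport along [k = lift ord0 j] or [k = ord0]. It is trivial because equality
    proofs between ordinals are unique. *)
Lemma ord_dffun_recl m (P : 'I_m.+1 -> Type) (u : P ord0)
    (v : forall j, P (lift ord0 j)) :
  exists f : forall k, P k, f ord0 = u /\ forall j, f (lift ord0 j) = v j.
Proof.
have cases (k : 'I_m.+1) : {j | k = lift ord0 j} + {k = ord0}.
  by case: (unliftP ord0 k) => [j ->|->]; [left; exists j|right].
exists (fun k => match cases k with
  | inleft (exist j e) => eq_rect_r P (v j) e
  | inright e => eq_rect_r P u e end); split=> [|j].
  case: (cases ord0) => [[j e]|e]; last by rewrite [e]eq_axiomK.
  by exfalso; have := neq_lift ord0 j; rewrite -e eqxx.
case: (cases _) => [[j' e]|e]; last first.
  by exfalso; have := neq_lift ord0 j; rewrite e eqxx.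
by have jj' := lift_inj e; subst j'; rewrite [e]eq_axiomK.
Qed.

Section DirectSums.
Variables (K : fieldType) (C : linear_category K).
Hypothesis C_additive : additive_category C.

(** An iterated biproduct is built, for which membership in a closed subcategory can be followed one
    summand at a time; uniqueness of direct sums then carries the equivalence over to all others. *)
Lemma closed_direct_sum_ex m (F : 'I_m -> C) :
  exists S, is_direct_sum F S /\
    forall X, closed_subcategory X -> (X S <-> forall k, X (F k)).
Proof.
elim: m F => [|m IH] F.
  have [[z z0] _] := C_additive; exists z; split; last first.
    by move=> X [X0 _]; split=> [_ []//|_]; exact: X0.
  by exists (fun k => 0), (fun k => 0); rewrite big_ord0; split=> [[]|[]|].
have [S1 [[i1 [p1 [pi1 pi01 ip1]]] XS1]] := IH (fun j => F (lift ord0 j)).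
have [S [iA [iB [pA [pB bip]]]]] := (proj2 C_additive) (F ord0) S1.
exists S; split; last first.
  move=> X Xc; split=> [/(proj2 Xc _ _ _ _ _ _ _ bip)[XA /(XS1 _ Xc) XB] k|XF].
    by case: (unliftP ord0 k) => [j ->|->].
  by apply/(proj2 Xc _ _ _ _ _ _ _ bip); split=> //; apply/(XS1 _ Xc) => j.
have [piA piB piAB piBA ip] := bip.
have [i [i0 iS]] := @ord_dffun_recl m (fun k => mor (F k) S) iA
  (fun j => iB \oc i1 j).
have [p [p0 pS]] := @ord_dffun_recl m (fun k => mor S (F k)) pA
  (fun j => p1 j \oc pB).
exists i, p; split=> [k|k l|].
- case: (unliftP ord0 k) => [j ->|->]; rewrite ?i0 ?p0 ?iS ?pS //.
  by rewrite -cmpA (cmpA pB) piB cmp1m pi1.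
- case: (unliftP ord0 k) => [j ->|->]; case: (unliftP ord0 l) => [j' ->|->];
    rewrite ?i0 ?p0 ?iS ?pS // ?eqxx //.
  + by rewrite (inj_eq lift_inj) => jj'; rewrite -cmpA (cmpA pB) piB cmp1m pi01.
  + by rewrite -cmpA piBA cmp0r.
  + by rewrite cmpA piAB cmp0l.
rewrite big_ord_recl i0 p0 -ip; congr (_ + _).
under eq_bigr => j _ do rewrite iS pS -cmpA (cmpA (i1 j)).
by rewrite -cmp_sumr -cmp_suml ip1 cmp1m.
Qed.

Lemma closed_direct_sum m (F : 'I_m -> C) S (X : set C) :
  closed_subcategory X -> is_direct_sum F S -> X S <-> forall k, X (F k).
Proof.
move=> Xc FS; have [S' [FS' XS']] := closed_direct_sum_ex F.
have [zero _] := C_additive.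
rewrite -(XS' _ Xc); split; apply: closed_subcategory_iso => //.
  exact: direct_sum_unique FS FS'.
exact: direct_sum_unique FS' FS.
Qed.

Variables (G : set C) (T : C).

(* The hypotheses say that composition with the [phi k] is a bijection from
   [\sum_k Hom(A, F k)] to [Hom(A, T)] for every A in G. *)
Lemma coreflection_direct_sum m (F : 'I_m -> C) (phi : forall k, mor (F k) T)
    (M : C) (f : mor M T) :
  (forall k, add_generated G (F k)) ->
  (forall A (u : mor A T), G A ->
     u = 0 \/ exists k (v : mor A (F k)), u = phi k \oc v) ->
  (forall A k l (v : mor A (F k)) (w : mor A (F l)), G A -> k <> l ->
     v = 0 \/ w = 0) ->
  (forall A k (v : mor A (F k)), G A -> phi k \oc v = 0 -> v = 0) ->
  add_generated G M ->
  (forall A (u : mor A T), add_generated G A -> exists v, u = f \oc v) ->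
  (forall A (v : mor A M), add_generated G A -> f \oc v = 0 -> v = 0) ->
  is_direct_sum F M.
Proof.
move=> GF surj disj inj GM fsurj finj.
have Gc := @closed_add_generated _ _ G.
have [S [FS XS]] := closed_direct_sum_ex F.
have [i [p [pi pi0 ip]]] := FS.
have GS : add_generated G S by apply/XS.
pose g : mor S T := \sum_k phi k \oc p k.
have gi k : g \oc i k = phi k.
  rewrite /g cmp_suml (bigD1 k) //= big1 => [|l lk].
    by rewrite addr0 -cmpA pi cmpm1.
  by rewrite -cmpA pi0 // cmp0r.
(* The objects A for which composition with [g] is a bijection from Hom(A, S) to Hom(A, T). They
   form a closed subcategory containing [G], hence all of [add_generated G]. *)
pose good := [set A : C | (forall u : mor A T, exists v, u = g \oc v) /\
  (forall v : mor A S, g \oc v = 0 -> v = 0)].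
have goodc : closed_subcategory good.
  split=> [z z0|A B D iA iB pA pB [piA piB piAB piBA ipAB]].
    by split=> [u|v _]; [exists 0; rewrite cmp0r|]; exact: is_zero_src.
  split=> [[sD jD]|[[sA jA] [sB jB]]].
    split; split=> [u|v gv].
    - have [v uv] := sD (u \oc pA); exists (v \oc iA).
      by rewrite cmpA -uv -cmpA piA cmpm1.
    - have vD : v \oc pA = 0 by apply: jD; rewrite cmpA gv cmp0l.
      by rewrite -[v]cmpm1 -piA cmpA vD cmp0l.
    - have [v uv] := sD (u \oc pB); exists (v \oc iB).
      by rewrite cmpA -uv -cmpA piB cmpm1.
    - have vD : v \oc pB = 0 by apply: jD; rewrite cmpA gv cmp0l.
      by rewrite -[v]cmpm1 -piB cmpA vD cmp0l.
  split=> [u|v gv].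
    have [v uv] := sA (u \oc iA); have [w uw] := sB (u \oc iB).
    exists (v \oc pA + w \oc pB).
    by rewrite cmpDr !cmpA -uv -uw -!cmpA -cmpDr ipAB cmpm1.
  rewrite -[v]cmpm1 -ipAB cmpDr !cmpA.
  have vA : v \oc iA = 0 by apply: jA; rewrite cmpA gv cmp0l.
  have vB : v \oc iB = 0 by apply: jB; rewrite cmpA gv cmp0l.
  by rewrite vA vB !cmp0l addr0.
have {goodc} Ggood A : add_generated G A -> good A.
  move=> /(_ good goodc); apply=> {}A GA; split=> [u|v gv].
    have [->|[k [v ->]]] := surj A u GA; first by exists 0; rewrite cmp0r.
    by exists (i k \oc v); rewrite cmpA gi.
  rewrite -[v]cmp1m -ip cmp_suml big1 // => k _.
  suff pv : p k \oc v = 0 by rewrite -cmpA pv cmp0r.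
  apply: inj => //.
  have [->|pv0] := pselect (p k \oc v = 0); first by rewrite cmp0r.
  rewrite -gv /g cmp_suml (bigD1 k) //= big1 => [|l lk].
    by rewrite addr0 cmpA.
  have kl : k <> l by move/eqP: lk => + kl; apply.
  have [//|pl0] := disj A k l (p k \oc v) (p l \oc v) GA kl.
  by rewrite -cmpA pl0 cmp0r.
apply: is_direct_sum_iso FS _.
(* Both [f] and [g] are now coreflections of [T] into [add_generated G], so each factors through the
   other and the two factors are mutually inverse. *)
have [w gw] := fsurj S g GS; have [sM jM] := Ggood M GM.
have [v fv] := sM f; have [_ jS] := Ggood S GS.
exists w, v; split; apply/eqP; rewrite -subr_eq0; apply/eqP.
  by apply: jS; rewrite cmpBr cmpA -fv -gw cmpm1 subrr.
by apply: finj => //; rewrite cmpBr cmpA -gw -fv cmpm1 subrr.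
Qed.

End DirectSums.

Section Opposite.
Variables (K : fieldType) (C : linear_category K).

(** Left transparent, so that its morphisms unfold to reversed morphisms of [C]; the criterion for
    reflections then becomes an instance of the one for coreflections. *)
Definition opposite_category : linear_category K.
Proof.
refine (@LinearCategory K C (fun A B => @mor K C B A) (@idm K C)
  (fun A B D g f => f \oc g) _ _ _ _ _).
- by move=> A B f; exact: cmpm1.
- by move=> A B f; exact: cmp1m.
- by move=> A B D E h g f; rewrite cmpA.
- by move=> A B D f; exact: cmp_linearr.
- by move=> A B D g; exact: cmp_linearl.
Defined.

Lemma is_biproduct_opposite (A B S : C) (iA : mor A S) (iB : mor B S)
    (pA : mor S A) (pB : mor S B) :
  is_biproduct iA iB pA pB -> @is_biproduct K opposite_category A B S pA pB iA iB.
Proof. by case=> ? ? ? ? ?; split. Qed.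

Lemma opposite_biproduct (A B S : C) (iA : mor A S) (iB : mor B S)
    (pA : mor S A) (pB : mor S B) :
  @is_biproduct K opposite_category A B S pA pB iA iB -> is_biproduct iA iB pA pB.
Proof. by case=> ? ? ? ? ?; split. Qed.

Lemma additive_opposite : additive_category C -> additive_category opposite_category.
Proof.
move=> [C0 biprod]; split=> // A B.
have [S [iA [iB [pA [pB S_biprod]]]]] := biprod A B.
by exists S, pA, pB, iA, iB; exact: is_biproduct_opposite.
Qed.

Lemma closed_subcategory_opposite (X : set C) :
  @closed_subcategory K opposite_category X <-> closed_subcategory X.
Proof.
split=> [[X0 Xsum]|[X0 Xsum]]; split=> // A B S iA iB pA pB biprod.
  exact: (Xsum _ _ _ _ _ _ _ (is_biproduct_opposite biprod)).
exact: (Xsum _ _ _ _ _ _ _ (opposite_biproduct biprod)).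
Qed.

Lemma add_generated_opposite (G : set C) :
  @add_generated K opposite_category G = add_generated G.
Proof.
by apply/seteqP; split=> A GA X /closed_subcategory_opposite Xc; exact: GA.
Qed.

Lemma is_direct_sum_opposite m (F : 'I_m -> C) S :
  @is_direct_sum K opposite_category m F S -> is_direct_sum F S.
Proof.
move=> [p [i [pi pi0 ip]]]; exists i, p; split=> // k l kl.
by apply: pi0; rewrite eq_sym.
Qed.

End Opposite.

Lemma reflection_direct_sum (K : fieldType) (C : linear_category K)
    (C_additive : additive_category C) (G : set C) (T : C)
    m (F : 'I_m -> C) (psi : forall k, mor T (F k)) (W : C) (g : mor T W) :
  (forall k, add_generated G (F k)) ->
  (forall A (u : mor T A), G A ->
     u = 0 \/ exists k (v : mor (F k) A), u = v \oc psi k) ->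
  (forall A k l (v : mor (F k) A) (w : mor (F l) A), G A -> k <> l ->
     v = 0 \/ w = 0) ->
  (forall A k (v : mor (F k) A), G A -> v \oc psi k = 0 -> v = 0) ->
  add_generated G W ->
  (forall A (u : mor T A), add_generated G A -> exists v, u = v \oc g) ->
  (forall A (v : mor W A), add_generated G A -> v \oc g = 0 -> v = 0) ->
  is_direct_sum F W.
Proof.
move=> GF surj disj inj GW gsurj ginj; apply: is_direct_sum_opposite.
by apply: (@coreflection_direct_sum K (opposite_category C)
  (additive_opposite C_additive) G T m F psi W g); rewrite ?add_generated_opposite.
Qed.

(** * Approximation triangles of a t-structure *)

(** The endomorphism [iA \oc pA] kills [iB] and its complement kills [iA]; whichever of the two is
    invertible forces the summand it kills to vanish. *)
Lemma local_endomorphisms_indecomposable (K : fieldType)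
    (C : linear_category K) (S : C) :
  local_endomorphisms S -> indecomposable S.
Proof.
move=> [S0 Sloc]; split=> // A B iA iB pA pB [piA piB piAB piBA ipAB].
have [[r [rf fr]]|[r [rf fr]]] := Sloc (iA \oc pA).
  right; rewrite /is_zero -piB -[pB]cmpm1 -fr !cmpA piBA.
  by rewrite !cmp0l.
left; rewrite /is_zero -piA -[pA]cmpm1 -fr.
by rewrite -ipAB addrAC subrr add0r !cmpA piAB !cmp0l.
Qed.

Section Triangulated.
Variables (K : fieldType) (C : triangulated_category K).
Implicit Types A B D S T : C.

Lemma triangulated_additive : additive_category C.
Proof. by split; [exact: zero_object|exact: biproducts]. Qed.

Lemma suspm0 A B : suspm (0 : mor A B) = 0.
Proof.
have := suspm_linear 1 (0 : mor A B) 0; rewrite !scale1r !addr0 => /eqP.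
by rewrite -subr_eq0 opprD addrA subrr sub0r oppr_eq0 => /eqP.
Qed.

Lemma is_zero_susp A : is_zero A -> is_zero (susp A).
Proof. by move=> A0; rewrite /is_zero -suspm1 A0 suspm0. Qed.

Section Triangle.
Variables (A B D : C) (f : mor A B) (g : mor B D) (h : mor D (susp A)).
Hypothesis fgh : distinguished f g h.

(** Exactness of Hom(S, -) at [B]. TR3, applied to the rotations of S -> S -> 0 and of the given
    triangle, yields a morphism from [susp S] to [susp A], which is the suspension of the lift up to
    the sign that both rotations share. *)
Lemma distinguished_lift S (k : mor S B) :
  g \oc k = 0 -> exists u, k = f \oc u.
Proof.
move=> gk; have [z z0] := zero_object C.
have S_tri := (proj1 (tr2 _ _ _)) (tr1_id S z0).
have [|w [_]] := tr3 (u := k) (v := 0) S_tri ((proj1 (tr2 _ _ _)) fgh).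
  by rewrite cmp0l gk.
have [j jK Kj] := @suspm_bij _ C S A.
rewrite suspm1 cmpNr cmpm1 cmpNl => /oppr_inj; rewrite -[w]Kj -suspmM => kE.
by exists (j w); exact: (bij_inj (@suspm_bij _ C S B)).
Qed.

Lemma distinguished_extend S (k : mor B S) :
  k \oc f = 0 -> exists v, k = v \oc g.
Proof.
move=> kf; have [z z0] := zero_object C.
have S_tri : @distinguished _ C z S S 0 (idm S) 0.
  by apply/tr2; rewrite suspm0 oppr0; apply: tr1_id; exact: is_zero_susp.
have [|w [wg _]] := tr3 (u := 0) (v := k) fgh S_tri; first by rewrite cmp0r.
by exists w; rewrite wg cmp1m.
Qed.

End Triangle.

Section TStructure.
Variables (X Y : set C).
Hypothesis XY : t_structure X Y.

Lemma t_structure_hom0 A B (u : mor A B) : X A -> Y B -> u = 0.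
Proof. by have [[_ _ + _] _] := XY; apply. Qed.

Section Approximation.
Variables (M T W : C) (f : mor M T) (g : mor T W) (h : mor W (susp M)).
Hypothesis fgh : approximation_triangle X Y f g h.

Lemma approximation_lift A (u : mor A T) : X A -> exists v, u = f \oc v.
Proof.
move=> XA; have [XM YW tri] := fgh; apply: (distinguished_lift tri).
exact: t_structure_hom0 XA YW.
Qed.

(** The obstruction is a morphism from [susp A] to [W], and it vanishes because the aisle is closed
    under suspension. This closure is what makes the lifts unique, and dually the extensions. *)
Lemma approximation_lift_inj A (v : mor A M) : X A -> f \oc v = 0 -> v = 0.
Proof.
move=> XA fv; have [XM YW tri] := fgh.
have [|w vw] := distinguished_lift
    ((proj1 (tr2 _ _ _)) ((proj1 (tr2 _ _ _)) tri)) (k := suspm v).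
  by rewrite cmpNl -suspmM fv suspm0 oppr0.
apply: (bij_inj (@suspm_bij _ C A M)).
rewrite suspm0 vw (t_structure_hom0 w _ YW) ?cmp0r //.
exact: (proj2 XY).
Qed.

Lemma approximation_extend D (u : mor T D) : Y D -> exists v, u = v \oc g.
Proof.
move=> YD; have [XM YW tri] := fgh; apply: (distinguished_extend tri).
exact: t_structure_hom0 XM YD.
Qed.

Lemma approximation_extend_inj D (v : mor W D) : Y D -> v \oc g = 0 -> v = 0.
Proof.
move=> YD vg; have [XM YW tri] := fgh.
have [w ->] := distinguished_extend ((proj1 (tr2 _ _ _)) tri) vg.
by rewrite (t_structure_hom0 w _ YD) ?cmp0l //; exact: (proj2 XY).
Qed.

End Approximation.

(** In the approximation triangle of [D] the map from the aisle part is zero by assumption; by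
    uniqueness of lifts the aisle part itself is zero, and [D] is isomorphic to its coaisle part. *)
Lemma coaisle_perp D : (forall A (u : mor A D), X A -> u = 0) -> Y D.
Proof.
move=> XD; have [[_ Yc _ approx] _] := XY.
have [A [B [f [g [h fgh]]]]] := approx D; have [XA YB tri] := fgh.
have f0 : f = 0 by exact: XD.
have A0 : is_zero A.
  by apply: (approximation_lift_inj fgh) => //; rewrite f0 cmp0l.
have [|s sg] := distinguished_extend tri (k := idm D).
  by rewrite f0 cmp0r.
apply: (closed_subcategory_iso Yc (zero_object C) _ YB).
exists s; exists g; split=> //.
have [|w wE] := distinguished_extend ((proj1 (tr2 _ _ _)) tri)
    (k := g \oc s - idm B).
  by rewrite cmpBl -cmpA -sg cmpm1 cmp1m subrr.
have /eqP : g \oc s - idm B = 0.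
  by rewrite wE (is_zero_src w) ?cmp0l //; exact: is_zero_susp.
by rewrite subr_eq0 => /eqP.
Qed.

Lemma coaisle_generated (G : set C) : krull_schmidt C ->
  (forall S, indecomposable S -> exists2 D, G D & isomorphic S D) ->
  Y = add_generated (G `&` Y).
Proof.
move=> KS Gind; have [[_ Yc _ _] _] := XY.
apply/seteqP; split=> [D YD|D]; last by apply=> // A [].
have Gc := @closed_add_generated _ C (G `&` Y).
have [m [F [Floc FD]]] := KS D.
apply/(closed_direct_sum triangulated_additive Gc FD) => k.
have YF := (proj1 (closed_direct_sum triangulated_additive Yc FD)) YD k.
have [D' GD' FD'] := Gind _ (local_endomorphisms_indecomposable (Floc k)).
have D'F : isomorphic D' (F k) by have [u [v [uv vu]]] := FD'; exists v, u.
apply: (closed_subcategory_iso Gc (zero_object C) D'F).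
apply: sub_add_generated; split=> //.
exact: closed_subcategory_iso Yc (zero_object C) FD' YF.
Qed.

End TStructure.

End Triangulated.

(** * The cyclic order of the circle *)

Section Angle.
Variable R : realType.
Implicit Types (p q w : R * R) (u s v : R).

Let two_pi_gt0 : 0 < 2 * pi :> R.
Proof. by rewrite mulr_gt0 ?pi_gt0. Qed.

Lemma unit_circle_point u : unit_circle (circle_point u).
Proof. by rewrite /unit_circle /= cos2Dsin2. Qed.

Lemma circle_point_addl u v s :
  circle_point u = circle_point v -> circle_point (u + s) = circle_point (v + s).
Proof. by move=> [cE sE]; rewrite /circle_point !cosD !sinD cE sE. Qed.

Lemma circle_point_periodic u : circle_point (u + 2 * pi) = circle_point u.
Proof. by rewrite /circle_point mulrC mulr_natr cosD2pi sinD2pi. Qed.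

(** Rotation by [- u] shows that v - u has cosine 1. As cosine is injective only on [0, pi], a
    difference d beyond pi is replaced by 2 pi - d. *)
Lemma circle_point_inj u v : 0 <= u < 2 * pi -> 0 <= v < 2 * pi ->
  circle_point u = circle_point v -> u = v.
Proof.
wlog uv : u v / u <= v => [ih hu hv uv|].
  by have [/ih|/ltW/ih] := leP u v; [exact|move=> /(_ hv hu (esym uv))].
move=> hu hv uvE; have /(circle_point_addl (- u)) := uvE.
rewrite subrr /circle_point cos0 sin0 => -[/esym cd _].
have pi0 := pi_gt0 R.
have [d_pi|pi_d] := leP (v - u) pi.
  have : v - u = 0.
    by apply: cos_inj; rewrite ?cos0 // in_itv /=; apply/andP; split; lra.
  lra.
have : 2 * pi - (v - u) = 0.
  apply: cos_inj; rewrite ?cos0 ?in_itv /=; [lra|lra|].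
  by rewrite addrC mulrC mulr_natr cosD2pi cosN.
lra.
Qed.

Lemma unit_circle_angle p : unit_circle p ->
  exists u, 0 <= u < 2 * pi /\ circle_point u = p.
Proof.
case: p => x y; rewrite /unit_circle /= => xy.
have pi0 := pi_gt0 R.
have y2 := sqr_ge0 y.
have x1 : -1 <= x <= 1 by apply/andP; split; nra.
have sE : Num.sqrt (1 - x ^+ 2) = `|y| by rewrite -xy addrAC subrr add0r sqrtr_sqr.
have a0 := acos_ge0 x1; have a1 := acos_lepi x1.
have [y0|y0] := leP 0 y.
  exists (acos x); split; first lra.
  by rewrite /circle_point acosK // sin_acos // sE ger0_norm.
have a0' : 0 < acos x.
  rewrite lt_neqAle a0 andbT; apply/eqP => /esym a0'.
  have := sin_acos x1; rewrite a0' sin0 sE => /esym/eqP.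
  by rewrite normr_eq0 => /eqP y0'; rewrite y0' ltxx in y0.
exists (2 * pi - acos x); split; first lra.
rewrite addrC circle_point_periodic /circle_point cosN sinN acosK //.
by rewrite sin_acos // sE ltr0_norm // opprK.
Qed.

(* [angle b p] in [0, 2 pi) is the length of the anti-clockwise walk from [b] to [p]. *)
Definition angle b p : R :=
  xget 0 [set s | 0 <= s < 2 * pi /\
    exists2 u, circle_point u = b & circle_point (u + s) = p].

Lemma angleP b p : unit_circle b -> unit_circle p ->
  0 <= angle b p < 2 * pi /\
  forall u, circle_point u = b -> circle_point (u + angle b p) = p.
Proof.
move=> /unit_circle_angle[u [u2 ub]] /unit_circle_angle[v [v2 vp]].
have [|a2 [w wb wp]] := @xgetPex _ 0 [set s | 0 <= s < 2 * pi /\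
    exists2 u, circle_point u = b & circle_point (u + s) = p].
  have [uv|vu] := leP u v.
    exists (v - u); split; first lra.
    by exists u => //; rewrite addrC subrK.
  exists (v - u + 2 * pi); split; first lra.
  by exists u => //; rewrite addrA circle_point_periodic addrC subrK.
split=> // t tb; rewrite -[RHS]wp; apply: circle_point_addl.
by rewrite tb.
Qed.

Lemma angle_unique b s u : 0 <= s < 2 * pi -> circle_point u = b ->
  angle b (circle_point (u + s)) = s.
Proof.
move=> s2 ub; have ub1 : unit_circle b by rewrite -ub; exact: unit_circle_point.
have [a2 /(_ u ub) aE] := angleP ub1 (unit_circle_point (u + s)).
apply: circle_point_inj => //; have := circle_point_addl (- u) aE.
by rewrite !(addrC u) !addrK.
Qed.

Definition cyc_lt u v s : bool := [|| u < v < s, v < s < u | s < u < v].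

Lemma angle_base b : unit_circle b -> angle b b = 0.
Proof.
move=> /unit_circle_angle[u [_ ub]]; rewrite -{2}ub -[u]addr0.
by apply: angle_unique => //; rewrite lexx two_pi_gt0.
Qed.

Lemma angle_inj b p q : unit_circle b -> unit_circle p -> unit_circle q ->
  angle b p = angle b q -> p = q.
Proof.
move=> b1 p1 q1 pq; have [u [_ ub]] := unit_circle_angle b1.
by rewrite -((angleP b1 p1).2 u ub) pq ((angleP b1 q1).2 u ub).
Qed.

Lemma cyc3_unit p q w : cyc3 p q w ->
  [/\ unit_circle p, unit_circle q & unit_circle w].
Proof. by move=> [u [s [v [_ [_ [-> -> ->]]]]]]; split; exact: unit_circle_point. Qed.

Lemma cyc3E b p q w : unit_circle b -> unit_circle p -> unit_circle q ->
  unit_circle w -> cyc3 p q w <-> cyc_lt (angle b p) (angle b q) (angle b w).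
Proof.
move=> b1 p1 q1 w1; have [u [_ ub]] := unit_circle_angle b1.
have [p2 /(_ u ub) pE] := angleP b1 p1.
have [q2 /(_ u ub) qE] := angleP b1 q1.
have [w2 /(_ u ub) wE] := angleP b1 w1.
have pi0 := two_pi_gt0.
split=> [[u' [s [v [sv [v2 [pE' qE' wE']]]]]]|].
  have up : circle_point u' = circle_point (u + angle b p) by rewrite pE.
  have angleD t : 0 < t < 2 * pi -> angle b (circle_point (u' + t)) =
      angle b p + t - (if angle b p + t < 2 * pi then 0 else 2 * pi).
    move=> t2; rewrite (circle_point_addl t up) -addrA.
    case: ifPn => [t3|]; first by rewrite subr0; apply: angle_unique => //; lra.
    rewrite -leNgt => t3; rewrite -[in LHS](subrK (2 * pi) (angle b p + t)).
    by rewrite addrA circle_point_periodic; apply: angle_unique => //; lra.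
  have qA := angleD s; have wA := angleD v; rewrite -qE' -wE' in qA wA.
  rewrite /cyc_lt qA ?wA; [|lra|lra].
  by case: (ltP (_ + s)) => ?; case: (ltP (_ + v)) => ?; lra.
rewrite /cyc_lt => pqw; exists (u + angle b p).
(* The length of the anti-clockwise walk from [p] to the point at angle [r] from [b]; a full turn is
   added when this walk passes [b]. *)
pose turn r : R := r - angle b p + (if angle b p < r then 0 else 2 * pi).
have turnE r : u + angle b p + turn r = u + r \/
    u + angle b p + turn r = u + r + 2 * pi.
  by rewrite /turn; case: ifP => _; [left|right]; lra.
exists (turn (angle b q)), (turn (angle b w)).
split; last split; last split=> //.
- rewrite /turn; case: (ltP _ (angle b q)) => ?; by case: (ltP _ (angle b w)) => ?; lra.
- by rewrite /turn; case: (ltP _ (angle b w)) => ?; lra.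
- by have [->|->] := turnE (angle b q); rewrite ?circle_point_periodic.
- by have [->|->] := turnE (angle b w); rewrite ?circle_point_periodic.
Qed.

End Angle.

(* A quantifier-free formula about the cyclic order of k circle points depends
   only on the ranks of their angles from the first point, so it is decided by
   enumerating the maps from the points to {0, ..., k-1}; [rank_search] prunes an
   enumeration branch as soon as the formula has a truth value. *)
Inductive cyc_form :=
  | CycLt of nat & nat & nat
  | CycEq of nat & nat
  | CycAnd of cyc_form & cyc_form
  | CycOr of cyc_form & cyc_form
  | CycImp of cyc_form & cyc_form
  | CycNot of cyc_form
  | CycFalse.

Fixpoint cyc_holds (R : realType) (env : nat -> R * R) (phi : cyc_form) : Prop :=
  match phi with
  | CycLt i j k => cyc3 (env i) (env j) (env k)
  | CycEq i j => env i = env j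
  | CycAnd p q => cyc_holds env p /\ cyc_holds env q
  | CycOr p q => cyc_holds env p \/ cyc_holds env q
  | CycImp p q => cyc_holds env p -> cyc_holds env q
  | CycNot p => ~ cyc_holds env p
  | CycFalse => False
  end.

Definition rank_lt (x y z : nat) : bool :=
  [|| (x < y < z)%N, (y < z < x)%N | (z < x < y)%N].

(** Three-valued logic: [None] means that points without a rank still leave the value open. A value
    [Some v] therefore holds for every extension of the partial ranking, which justifies the
    pruning. *)
Fixpoint rank_eval (s : seq nat) (phi : cyc_form) : option bool :=
  match phi with
  | CycLt i j k =>
    if (onth s i, onth s j, onth s k) is (Some x, Some y, Some z)
    then Some (rank_lt x y z) else None
  | CycEq i j =>
    if (onth s i, onth s j) is (Some x, Some y) then Some (x == y)
    else None
  | CycAnd p q =>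
    match rank_eval s p with
    | Some false => Some false
    | Some true => rank_eval s q
    | None => if rank_eval s q is Some false then Some false else None
    end
  | CycOr p q =>
    match rank_eval s p with
    | Some true => Some true
    | Some false => rank_eval s q
    | None => if rank_eval s q is Some true then Some true else None
    end
  | CycImp p q =>
    match rank_eval s p with
    | Some false => Some true
    | Some true => rank_eval s q
    | None => if rank_eval s q is Some true then Some true else None
    end
  | CycNot p => omap negb (rank_eval s p)
  | CycFalse => Some false
  end.

Fixpoint rank_search (ranks : seq nat) (n : nat) (s : seq nat) (phi : cyc_form) :
    bool :=
  match rank_eval s phi with
  | Some b => b
  | None => if n is n'.+1
            then all (fun v => rank_search ranks n' (rcons s v) phi) ranks
            else false
  end.

Section Soundness.
Variables (R : realType) (b : R * R) (ps : seq (R * R)).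
Hypothesis ps_unit : forall p, p \in b :: ps -> unit_circle p.
Let env i := nth b (b :: ps) i.
Let ang i := angle b (env i).
(** Counting the points of strictly smaller angle gives coinciding points the same rank, so
    equalities are reflected as well as the order, and keeps all ranks in the range that is
    enumerated. *)
Let rank i := #|[pred j : 'I_(size ps).+1 | ang j < ang i]|.

Let env_unit i : unit_circle (env i).
Proof.
rewrite /env; have [i_lt|i_ge] := ltnP i (size (b :: ps)).
  by apply: ps_unit; exact: mem_nth.
by rewrite nth_default //; apply: ps_unit; rewrite mem_head.
Qed.

Let b_unit : unit_circle b. Proof. exact: (env_unit 0). Qed.

Let rank_ltE i j : (i < (size ps).+1)%N -> (rank i < rank j)%N = (ang i < ang j).
Proof.
move=> i_lt; have [ij|ji] := ltP (ang i) (ang j).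
  apply: proper_card; apply/properP; split.
    by apply/fintype.subsetP => m; rewrite !inE => mi; exact: lt_trans mi ij.
  by exists (Ordinal i_lt); rewrite !inE //= ltxx.
apply/negbTE; rewrite -leqNgt; apply: subset_leq_card.
by apply/fintype.subsetP => m; rewrite !inE => mj; exact: lt_le_trans mj ji.
Qed.

Let rank_eqE i j : (i < (size ps).+1)%N -> (j < (size ps).+1)%N ->
  (rank i == rank j) = (ang i == ang j).
Proof.
move=> i_lt j_lt; rewrite eqn_leq (leqNgt (rank i)) (leqNgt (rank j)).
by rewrite !rank_ltE // eq_le !leNgt.
Qed.

Let rank0 : rank 0 = 0%N.
Proof.
apply: eq_card0 => j; rewrite !inE /ang (angle_base b_unit).
by apply/negbTE; rewrite -leNgt; have [/andP[]] := angleP b_unit (env_unit j).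
Qed.

Let rank_size i : (i < (size ps).+1)%N -> (rank i < (size ps).+1)%N.
Proof.
move=> i_lt; rewrite -[X in (_ < X)%N]card_ord; apply: proper_card.
by apply/properP; split; [exact/fintype.subsetP|exists (Ordinal i_lt); rewrite ?inE ?ltxx].
Qed.

Let ranks m := mkseq rank m.

Let onth_ranks m i x : (m <= (size ps).+1)%N -> onth (ranks m) i = Some x ->
  (i < (size ps).+1)%N /\ x = rank i.
Proof.
move=> m_le; have [im|mi] := ltnP i m.
  by move=> /(onth_nth 0%N); rewrite nth_mkseq // => <-; split=> //; exact: leq_trans m_le.
by rewrite onth_default // size_mkseq.
Qed.

Let rank_evalP m phi v : (m <= (size ps).+1)%N ->
  rank_eval (ranks m) phi = Some v -> reflect (cyc_holds env phi) v.
Proof.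
move=> m_le; elim: phi v => [i j k|i j|p IHp q IHq|p IHp q IHq|p IHp q IHq
    |p IHp|] v /=.
- case iE: onth => [x|//]; case jE: onth => [y|//]; case kE: onth => [z|//] [<-].
  have [[i_lt ->] [j_lt ->]] := (onth_ranks m_le iE, onth_ranks m_le jE).
  have [k_lt ->] := onth_ranks m_le kE.
  apply: (equivP idP); rewrite (cyc3E b_unit) //.
  by rewrite /rank_lt /cyc_lt !rank_ltE.
- case iE: onth => [x|//]; case jE: onth => [y|//] [<-].
  have [[i_lt ->] [j_lt ->]] := (onth_ranks m_le iE, onth_ranks m_le jE).
  rewrite rank_eqE //; apply: (equivP eqP); split; last by rewrite /ang => ->.
  exact: angle_inj.
- case: (rank_eval _ p) IHp => [[]|] IHp.
  + move=> /IHq qv; have /(_ _ erefl) /elimT/(_ isT) := IHp => hp.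
    by apply: (equivP qv); tauto.
  + move=> [<-]; apply: ReflectF => -[hp _].
    by have /(_ _ erefl)/elimF/(_ erefl) := IHp; apply.
  + case: (rank_eval _ q) IHq => [[]|] // IHq [<-]; apply: ReflectF => -[_ hq].
    by have /(_ _ erefl)/elimF/(_ erefl) := IHq; apply.
- case: (rank_eval _ p) IHp => [[]|] IHp.
  + by move=> [<-]; apply: ReflectT; left; exact: (elimT (IHp _ erefl)).
  + move=> /IHq qv; apply: (equivP qv); have := elimF (IHp _ erefl) erefl.
    by tauto.
  + case: (rank_eval _ q) IHq => [[]|] // IHq [<-]; apply: ReflectT; right.
    exact: (elimT (IHq _ erefl)).
- case: (rank_eval _ p) IHp => [[]|] IHp.
  + move=> /IHq qv; apply: (equivP qv); have := elimT (IHp _ erefl) isT.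
    by tauto.
  + by move=> [<-]; apply: ReflectT => /(elimF (IHp _ erefl) erefl).
  + case: (rank_eval _ q) IHq => [[]|] // IHq [<-]; apply: ReflectT => _.
    exact: (elimT (IHq _ erefl)).
- case: (rank_eval _ p) IHp => [w|] // IHp [<-].
  by apply: (iffP negP) => hp hp'; apply: hp; apply/(IHp _ erefl).
- by move=> [<-]; exact: ReflectF.
Qed.

(** A successful search has found the formula true on every branch, in particular on the branch of
    the actual ranks, which is the one followed here. *)
Let rank_searchP n m phi : (m + n = (size ps).+1)%N ->
  rank_search (iota 0 (size ps).+1) n (ranks m) phi -> cyc_holds env phi.
Proof.
move ksE: (iota 0 (size ps).+1) => ks.
elim: n m => [|n IH] m /= mn; case vE: rank_eval => [v|] //.
- by move=> ?; apply/(rank_evalP _ vE) => //; rewrite -mn addn0.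
- by move=> ?; apply/(rank_evalP _ vE) => //; rewrite -mn leq_addr.
move=> /seq.allP rsearch.
apply: (IH m.+1); first by rewrite addSnnS.
rewrite /ranks mkseqS; apply: rsearch; rewrite -ksE mem_iota; apply: rank_size.
lia.
Qed.

Lemma rank_search_sound phi :
  rank_search (iota 0 (size ps).+1) (size ps) [:: 0%N] phi -> cyc_holds env phi.
Proof.
(* The base point is at angle 0 from itself, so its rank is known in advance and only the other
   points are enumerated. *)
have <- : ranks 1 = [:: 0%N] by rewrite /ranks mkseqS /mkseq /= rank0.
exact: rank_searchP.
Qed.

End Soundness.

Lemma cyc_decide (R : realType) (b : R * R) (ps : seq (R * R)) (phi : cyc_form) :
  foldr (fun p P => unit_circle p /\ P) True (b :: ps) ->
  rank_search (iota 0 (size ps).+1) (size ps) [:: 0%N] phi ->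
  cyc_holds (nth b (b :: ps)) phi.
Proof.
move=> units; apply: rank_search_sound; elim: (b :: ps) units => //= q l IH [q1 l1] p.
by rewrite inE => /orP[/eqP ->|/(IH l1)].
Qed.

(** Reification deals with binary conjunctions only. An equality of propositions lets [circ] rewrite
    at any place of the goal. *)
Lemma cyc4E (R : realType) (p q w r : R * R) :
  cyc4 p q w r = ((cyc3 p q w /\ cyc3 q w r) /\ (cyc3 w r p /\ cyc3 r p q)).
Proof. by apply: boolp.propext; split=> [[? ? ? ?]|[[? ?] [? ?]]]; do ?split. Qed.

Ltac cyc_add x l :=
  lazymatch l with
  | nil => constr:(x :: nil)
  | x :: _ => l
  | ?y :: ?l' => let l2 := cyc_add x l' in constr:(y :: l2)
  end.

Ltac cyc_points phi l :=
  lazymatch phi with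
  | cyc3 ?x ?y ?z =>
    let l := cyc_add x l in let l := cyc_add y l in cyc_add z l
  | @eq _ ?x ?y => let l := cyc_add x l in cyc_add y l
  | ?p /\ ?q => let l := cyc_points p l in cyc_points q l
  | ?p \/ ?q => let l := cyc_points p l in cyc_points q l
  | ~ ?p => cyc_points p l
  | ?p -> ?q => let l := cyc_points p l in cyc_points q l
  | False => l
  end.

Ltac cyc_index x l :=
  lazymatch l with
  | x :: _ => constr:(0%N)
  | _ :: ?l' => let n := cyc_index x l' in constr:(n.+1)
  end.

Ltac cyc_reify phi l :=
  lazymatch phi with
  | cyc3 ?x ?y ?z =>
    let i := cyc_index x l in let j := cyc_index y l in
    let k := cyc_index z l in constr:(CycLt i j k)
  | @eq _ ?x ?y =>
    let i := cyc_index x l in let j := cyc_index y l in constr:(CycEq i j)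
  | ?p /\ ?q =>
    let p := cyc_reify p l in let q := cyc_reify q l in constr:(CycAnd p q)
  | ?p \/ ?q =>
    let p := cyc_reify p l in let q := cyc_reify q l in constr:(CycOr p q)
  | ~ ?p => let p := cyc_reify p l in constr:(CycNot p)
  | ?p -> ?q =>
    let p := cyc_reify p l in let q := cyc_reify q l in constr:(CycImp p q)
  | False => constr:(CycFalse)
  end.

Ltac circle_side := first [assumption | eauto with circle].

(** The facts to be used have to stand as premises in the goal. The first point met becomes the base
    point; that the points lie on the circle is taken from the hypotheses or from the hints in
    [circle]. *)
Ltac circ :=
  rewrite /cross ?cyc4E;
  lazymatch goal with
  | |- ?phi =>
    lazymatch phi with
    | context [@cyc3 ?R _ _ _] =>
      let l := cyc_points phi (@nil (R * R)) in
      lazymatch l with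
      | ?b :: ?ps =>
        let f := cyc_reify phi l in
        change (cyc_holds (nth b (b :: ps)) f);
        apply: cyc_decide; [cbn [foldr]; repeat split; circle_side
                           |vm_compute; reflexivity]
      end
    end
  end.

(** * Admissible sets *)

Section Admissible.
Variables (R : realType) (n : nat) (Z : set (R * R)) (a : 'I_n -> R * R).
Hypothesis adm : admissible Z a.
Implicit Types p q v w z : R * R.

Lemma adm_unit p : Z p -> unit_circle p.
Proof. by have [[Z1 _] _ _ _ _] := adm; exact: Z1. Qed.

(** Admissibility provides, for any [p] on the circle other than [a i], some [z] with
    [cyc3 p z (a i)], and this relation holds only between points of the circle. *)
Lemma limit_unit i : unit_circle (a i).
Proof.
have [p [p1 pa]] : exists p, unit_circle p /\ p <> a i.
  have [<-|] := pselect (circle_point 0 = a i); last first.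
    by exists (circle_point 0); split=> //; exact: unit_circle_point.
  exists (circle_point pi); split; first exact: unit_circle_point.
  by rewrite /circle_point cospi cos0 => -[]; lra.
have [_ _ _ _ /(_ i p p1 pa)[pz _]] := adm.
by have [z [[_ /cyc3_unit[]]]] := pz setT filterT.
Qed.

Lemma limit_notin i : ~ Z (a i).
Proof.
have [_ _ [_ aE] _ _] := adm.
have : range a (a i) by exists i.
by rewrite aE => -[].
Qed.

Lemma closure_adm p : closure Z p <-> Z p \/ exists i, p = a i.
Proof.
have [_ _ [_ aE] _ _] := adm; split=> [Zp|[/subset_closure//|[i ->]]].
  have [|nZp] := pselect (Z p); first by left.
  have : range a p by rewrite aE; split.
  by move=> [i _ <-]; right; exists i.
have : range a (a i) by exists i.
by rewrite aE => -[].
Qed.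

Lemma closure_unit p : closure Z p -> unit_circle p.
Proof. by move=> /closure_adm[/adm_unit//|[i ->]]; exact: limit_unit. Qed.

Lemma limit_before i p : unit_circle p -> p <> a i ->
  exists2 z, Z z & cyc3 p z (a i).
Proof.
move=> p1 pa; have [_ _ _ _ /(_ i p p1 pa)[pz _]] := adm.
by have [z [[Zz zP] _]] := pz setT filterT; exists z.
Qed.

Lemma limit_after i p : unit_circle p -> p <> a i ->
  exists2 z, Z z & cyc3 (a i) z p.
Proof.
move=> p1 pa; have [_ _ _ _ /(_ i p p1 pa)[_ pz]] := adm.
by have [z [[Zz zP] _]] := pz setT filterT; exists z.
Qed.

Lemma circle_point_continuous (f : R -> R) :
  continuous f -> continuous (@circle_point R \o f).
Proof.
move=> fc s.
have ccos : cos (f r) @[r --> s] --> cos (f s).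
  by apply: continuous_comp; [exact: fc|exact: continuous_cos].
have csin : sin (f r) @[r --> s] --> sin (f s).
  by apply: continuous_comp; [exact: fc|exact: continuous_sin].
exact: (cvg_pair ccos csin).
Qed.

(** The curve [c] is abstract so that the result serves successors and, with reversed orientation,
    predecessors. The infimum [m] of the positive parameters of points of [Z] is attained: otherwise
    points of [Z] accumulate at [c m], which by discreteness is not in [Z] and so is a limit point;
    but a limit point is also approached along smaller parameters, by the last hypothesis. *)
Lemma nearest_ex (c : R -> R * R) :
  continuous c -> Z (c 0) ->
  (forall s t, 0 <= s < 2 * pi -> 0 <= t < 2 * pi -> c s = c t -> s = t) ->
  (forall p, unit_circle p -> exists2 s, 0 <= s < 2 * pi & c s = p) ->
  (forall i m, 0 < m < 2 * pi -> c m = a i -> exists2 s, 0 < s < m & Z (c s)) ->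
  exists m, [/\ 0 < m < 2 * pi, Z (c m) & forall s, 0 < s < m -> ~ Z (c s)].
Proof.
move=> cc Z0 cinj csurj clim; pose S : set R := [set s | 0 < s < 2 * pi /\ Z (c s)].
have S0 : S !=set0.
  have [_ Zinf _ _ _] := adm.
  have [z [Zz z0]] : exists z, Z z /\ z <> c 0.
    apply: contrapT => none; apply: Zinf; apply: (sub_finite_set _ (finite_set1 (c 0))).
    by move=> z Zz /=; apply: contrapT => z0; apply: none; exists z.
  have [s s2 sz] := csurj z (adm_unit Zz); exists s; split; last by rewrite sz.
  suff : s != 0 by move=> ?; apply/andP; split; lra.
  by apply/eqP => s0; apply: z0; rewrite -sz s0.
have Sinf : has_inf S by split=> //; exists 0 => s [/andP[/ltW]].
pose m := inf S.
have m_lb s : S s -> m <= s by move=> Ss; apply: ge_inf => //; case: Sinf.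
have m0 : 0 <= m by apply: lb_le_inf => // s [/andP[/ltW]].
have m2 : m < 2 * pi.
  by have [s Ss] := S0; apply: le_lt_trans (m_lb _ Ss) _; case: Ss => /andP[].
have [Sm|nSm] := pselect (S m).
  exists m; split; [by case: Sm|by case: Sm|move=> s /andP[s0 sm] Zs].
  have : m <= s by apply: m_lb; split=> //; rewrite s0 (lt_trans sm).
  by rewrite leNgt sm.
have adh (V : set (R * R)) : nbhs (c m) V ->
    exists z, [/\ V z, Z z & z <> c m].
  move=> /cc /nbhs_ballP[e /= e0 eV].
  have [s Ss sm] := inf_adherent e0 Sinf.
  have ms : m < s.
    by rewrite lt_neqAle m_lb // andbT; apply/eqP => ms; apply: nSm; rewrite ms.
  exists (c s); split; [|by case: Ss|].
    apply: eV; rewrite /ball /= distrC ger0_norm; last lra.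
    by rewrite -/m in sm; lra.
  have [s2 _] := Ss; move=> /(cinj _ _ _ _) smE.
  by have : s = m; [apply: smE; lra|lra].
have nZm : ~ Z (c m).
  move=> Zm; have [[_ /(_ _ Zm)[_ [V Vm VZ]]] _ _ _ _] := adm.
  have [z [Vz Zz zm]] := adh V Vm; apply: zm.
  by have : (V `&` Z) z by []; rewrite VZ.
have /closure_adm[//|[i mi]] : closure Z (c m).
  by move=> V /adh[z [Vz Zz _]]; exists z.
have m_gt0 : 0 < m.
  by rewrite lt_neqAle m0 andbT; apply/eqP => mE; apply: nZm; rewrite -mE.
have [|s sm Zs] := clim i m _ mi; first lra.
have : m <= s by apply: m_lb; split=> //; lra.
lra.
Qed.

Lemma cyc3_circle_point (u s t : R) : 0 <= s < 2 * pi -> 0 <= t < 2 * pi ->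
  cyc3 (circle_point u) (circle_point (u + s)) (circle_point (u + t)) <->
  0 < s < t.
Proof.
move=> s2 t2; have u1 := unit_circle_point u; have pi0 := pi_gt0 R.
rewrite (cyc3E u1 u1 (unit_circle_point _) (unit_circle_point _)).
rewrite (angle_base u1) !(angle_unique _ (erefl (circle_point u))) //.
by rewrite /cyc_lt; split=> h; lra.
Qed.

Lemma cyc3_circle_pointN (u s t : R) : 0 <= s < 2 * pi -> 0 <= t < 2 * pi ->
  cyc3 (circle_point (u - t)) (circle_point (u - s)) (circle_point u) <->
  0 < s < t.
Proof.
move=> s2 t2; have u1 := unit_circle_point u; have pi0 := pi_gt0 R.
have angleN r : 0 <= r < 2 * pi ->
    angle (circle_point u) (circle_point (u - r)) = if r == 0 then 0 else 2 * pi - r.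
  move=> r2; case: eqP => [->|/eqP r0]; first by rewrite subr0 angle_base.
  rewrite -(circle_point_periodic (u - r)) -addrA (addrC (- r)).
  by apply: angle_unique => //; lra.
rewrite (cyc3E u1 (unit_circle_point _) (unit_circle_point _) u1).
rewrite (angle_base u1) !angleN // /cyc_lt.
by case: (eqVneq s 0) => s0; case: (eqVneq t 0) => t0; split=> h; lra.
Qed.

Lemma succ_ex z : Z z -> exists w, [/\ Z w, w <> z & forall v, Z v -> ~ cyc3 z v w].
Proof.
move=> Zz; have [u [u2 uz]] := unit_circle_angle (adm_unit Zz).
have z1 := adm_unit Zz; have pi0 := pi_gt0 R; pose c s := circle_point (u + s).
have c0 : c 0 = z by rewrite /c addr0.
have chart p : unit_circle p -> exists2 s, 0 <= s < 2 * pi & c s = p.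
  by move=> p1; have [p2 /(_ u uz) pE] := angleP z1 p1; exists (angle z p).
have inj s t : 0 <= s < 2 * pi -> 0 <= t < 2 * pi -> c s = c t -> s = t.
  by move=> s2 t2 st; rewrite -(angle_unique s2 uz) -/(c s) st angle_unique.
have cc : continuous c.
  by apply: circle_point_continuous => s; apply: cvgD; [exact: cvg_cst|exact: cvg_id].
have lim i m : 0 < m < 2 * pi -> c m = a i -> exists2 s, 0 < s < m & Z (c s).
  move=> m2 mi; have [|w Zw] := limit_before (i := i) z1.
    by move=> zi; apply: (@limit_notin i); rewrite -zi.
  have [s s2 sw] := chart w (adm_unit Zw); rewrite -mi -uz -sw => zw.
  exists s; last by rewrite sw.
  have m2' : 0 <= m < 2 * pi by lra.
  exact: (cyc3_circle_point u s2 m2').1 zw.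
have Zc0 : Z (c 0) by rewrite c0.
have [m [m2 Zm mS]] := nearest_ex cc Zc0 inj chart lim.
exists (c m); split=> // [mz|v Zv].
  have : m = 0 by apply: inj; rewrite ?c0 //; lra.
  lra.
have [s s2 sv] := chart v (adm_unit Zv); rewrite -uz -sv => sm.
have m2' : 0 <= m < 2 * pi by lra.
by apply: (mS s); [exact: (cyc3_circle_point u s2 m2').1 sm|rewrite sv].
Qed.

Lemma pred_ex z : Z z -> exists w, [/\ Z w, w <> z & forall v, Z v -> ~ cyc3 w v z].
Proof.
move=> Zz; have [u [u2 uz]] := unit_circle_angle (adm_unit Zz).
have z1 := adm_unit Zz; have pi0 := pi_gt0 R; pose c s := circle_point (u - s).
have c0 : c 0 = z by rewrite /c subr0.
have chart p : unit_circle p -> exists2 s, 0 <= s < 2 * pi & c s = p.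
  move=> p1; have [p2 /(_ u uz) pE] := angleP z1 p1.
  have [p0|p0] := eqVneq (angle z p) 0.
    by exists 0; [lra|rewrite c0 -pE p0 addr0].
  exists (2 * pi - angle z p); first lra.
  by rewrite /c opprB addrA -[LHS]circle_point_periodic subrK.
have inj s t : 0 <= s < 2 * pi -> 0 <= t < 2 * pi -> c s = c t -> s = t.
  move=> s2 t2 st; have := circle_point_addl (s + t) st.
  have -> : u - s + (s + t) = u + t by lra.
  have -> : u - t + (s + t) = u + s by lra.
  by move=> ts; rewrite -(angle_unique s2 uz) -ts angle_unique.
have cc : continuous c.
  apply: circle_point_continuous => s; apply: cvgB; [exact: cvg_cst|exact: cvg_id].
have lim i m : 0 < m < 2 * pi -> c m = a i -> exists2 s, 0 < s < m & Z (c s).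
  move=> m2 mi; have [|w Zw] := limit_after (i := i) z1.
    by move=> zi; apply: (@limit_notin i); rewrite -zi.
  have [s s2 sw] := chart w (adm_unit Zw); rewrite -mi -uz -sw => zw.
  exists s; last by rewrite sw.
  have m2' : 0 <= m < 2 * pi by lra.
  exact: (cyc3_circle_pointN u s2 m2').1 zw.
have Zc0 : Z (c 0) by rewrite c0.
have [m [m2 Zm mS]] := nearest_ex cc Zc0 inj chart lim.
exists (c m); split=> // [mz|v Zv].
  have : m = 0 by apply: inj; rewrite ?c0 //; lra.
  lra.
have [s s2 sv] := chart v (adm_unit Zv); rewrite -uz -sv => sm.
have m2' : 0 <= m < 2 * pi by lra.
by apply: (mS s); [exact: (cyc3_circle_pointN u s2 m2').1 sm|rewrite sv].
Qed.

Lemma succP z : Z z ->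
  [/\ Z (succ_pt Z z), succ_pt Z z <> z & forall v, Z v -> ~ cyc3 z v (succ_pt Z z)].
Proof. by move=> /succ_ex; exact: (@xgetPex _ z). Qed.

Lemma predP z : Z z ->
  [/\ Z (pred_pt Z z), pred_pt Z z <> z & forall v, Z v -> ~ cyc3 (pred_pt Z z) v z].
Proof. by move=> /pred_ex; exact: (@xgetPex _ z). Qed.

Lemma succ_in z : Z z -> Z (succ_pt Z z). Proof. by move=> /succP[]. Qed.

Lemma pred_in z : Z z -> Z (pred_pt Z z). Proof. by move=> /predP[]. Qed.

Local Hint Resolve adm_unit closure_unit limit_unit : circle.

Lemma succK z : Z z -> pred_pt Z (succ_pt Z z) = z.
Proof.
move=> Zz; have [Zs sz /(_ (pred_pt Z (succ_pt Z z))) sP] := succP Zz.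
have [Zp ps /(_ z Zz)] := predP Zs; move: (sP Zp) sz ps.
circ.
Qed.

Lemma predK z : Z z -> succ_pt Z (pred_pt Z z) = z.
Proof.
move=> Zz; have [Zs sz /(_ (succ_pt Z (pred_pt Z z))) sP] := predP Zz.
have [Zp ps /(_ z Zz)] := succP Zs; move: (sP Zp) sz ps.
circ.
Qed.

End Admissible.

#[local] Hint Resolve adm_unit closure_unit limit_unit : circle.

(** * Blocks of a decorated partition *)

Section Blocks.
Variables (R : realType) (n : nat) (Z : set (R * R)) (a : 'I_n -> R * R).
Hypothesis n_ge2 : (2 <= n)%N.
Hypothesis adm : admissible Z a.
Implicit Types p q u v w z : R * R.

(** A limit point strictly between [u] and its successor would be preceded by points of [Z] lying
    after [u]. *)
Lemma closure_succ u q : Z u -> closure Z q -> ~ cyc3 u q (succ_pt Z u).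
Proof.
move=> Zu /(closure_adm adm)[Zq|[i ->]]; first by have [_ _] := succP adm Zu; exact.
move=> uas; have [|v Zv] := limit_before adm (i := i) (adm_unit adm Zu).
  by move=> ua; apply: (@limit_notin _ _ _ _ adm i); rewrite -ua.
have [Zs _ /(_ v Zv)] := succP adm Zu; move: uas.
circ.
Qed.

Definition sector i p := cyc3 (a i) p (a (ordS i)).

(** The circle is cut open at the limit point of index 0. This links the cyclic order of sectors
    with the linear order of indices in which non-crossing partitions are stated. *)
Let i0 : 'I_n := Ordinal (leq_trans (isT : 0 < 2)%N n_ge2).

Let a_inj : injective a. Proof. by have [_ _ []] := adm. Qed.

Let a_order (i j : 'I_n) : (0 < i < j)%N -> cyc3 (a i0) (a i) (a j).
Proof. by move=> ij; have [_ _ _ + _] := adm; apply. Qed.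

Let a0_order i : a i0 = a i \/ (0 < i)%N.
Proof.
by have [i_eq0|] := posnP i; [left; congr a; exact: val_inj|right].
Qed.

Let ordSE i : (ordS i = i.+1 :> nat) \/ (i.+1 = n /\ ordS i = i0).
Proof.
have [lt|ge] := ltnP i.+1 n; first by left; rewrite /= modn_small.
have ni : i.+1 = n by apply/eqP; rewrite eqn_leq ge ltn_ord.
by right; split=> //; apply: val_inj; rewrite /= ni modnn.
Qed.

Lemma neq_ordS (i : 'I_n) : ordS i <> i.
Proof.
move=> iE; have [|[ni i0E]] := ordSE i; first by rewrite iE; lia.
by move: ni n_ge2; rewrite -iE i0E /=; lia.
Qed.

Lemma limit_neqS (i : 'I_n) : a (ordS i) <> a i.
Proof. by move=> /a_inj/neq_ordS. Qed.

Lemma sector_lt (i j : 'I_n) p q : (i < j)%N -> sector i p -> sector j q ->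
  cyc3 (a i0) p q.
Proof.
move=> ij si sj; have [_ p1 _] := cyc3_unit si; have [_ q1 _] := cyc3_unit sj.
have hi : a i0 = a i \/ cyc3 (a i0) (a i) (a (ordS i)).
  have [|i_gt0] := a0_order i; first by left.
  right; have [Si|[ni _]] := ordSE i; first by apply: a_order; lia.
  by have := ltn_ord j; lia.
have hij : a (ordS i) = a j \/ cyc3 (a i0) (a (ordS i)) (a j).
  have [Si|[ni _]] := ordSE i; last by have := ltn_ord j; lia.
  have [jE|jS] := eqVneq (j : nat) i.+1.
    by left; congr a; apply: val_inj; exact: etrans Si (esym jE).
  by right; apply: a_order; lia.
have hj : a (ordS j) = a i0 \/ cyc3 (a i0) (a j) (a (ordS j)).
  have [Sj|[_ ->]] := ordSE j; last by left.
  by right; apply: a_order; lia.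
have hS := @limit_neqS i.
have hj0 : a i0 <> a j by move=> /a_inj j0; move: ij; rewrite -j0.
move: hi hij hj hS hj0 si sj; rewrite /sector.
circ.
Qed.

Lemma sector_neq i p : sector i p -> p <> a i0.
Proof.
move=> si; have [_ p1 _] := cyc3_unit si.
have hi : a i0 = a i \/ a (ordS i) = a i0 \/ cyc3 (a i0) (a i) (a (ordS i)).
  have [|i_gt0] := a0_order i; first by left.
  have [Si|[_ ->]] := ordSE i; last by right; left.
  by right; right; apply: a_order; lia.
move: hi si; rewrite /sector.
circ.
Qed.

Lemma sector_unique i j p : sector i p -> sector j p -> i = j.
Proof.
move=> si sj; have p1 : unit_circle p by have [_ + _] := cyc3_unit si.
have nlt (k l : 'I_n) : sector k p -> sector l p -> ~ (k < l)%N.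
  by move=> sk sl kl; have := sector_lt kl sk sl; circ.
by apply: val_inj => /=; have := nlt _ _ si sj; have := nlt _ _ sj si; lia.
Qed.

Lemma limit_sector i k : ~ sector i (a k).
Proof.
have : a k = a i \/ a k = a (ordS i) \/ cyc3 (a i) (a (ordS i)) (a k).
  have [->|ki] := eqVneq k i; first by left.
  have [->|kS] := eqVneq k (ordS i); first by right; left.
  right; right; have [_ _ _ aO _] := adm.
  have {}ki : (k : nat) <> i by move=> /val_inj kE; rewrite kE eqxx in ki.
  have {}kS : (k : nat) <> ordS i by move=> /val_inj kE; rewrite kE eqxx in kS.
  have [Si|[ni S0]] := ordSE i.
    have [ki'|ik] := ltnP k i; last by apply: aO; lia.
    have : cyc3 (a k) (a i) (a (ordS i)) by apply: aO; lia.
    by circ.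
  have : cyc3 (a (ordS i)) (a k) (a i).
    by apply: aO; have := ltn_ord k; rewrite S0 /= in kS *; lia.
  by circ.
by rewrite /sector; circ.
Qed.

Section Decoration.
Variables (P : {set {set 'I_n}}) (x : 'I_n -> R * R).
Hypothesis nc : noncrossing_partition P.
Hypothesis dec : decoration Z a P x.

(** An interval (a_i, x_i] contains a limit point when [x i] is the next one; ends of arcs are only
    the points in [Z]. *)
Definition block_pts (B : {set 'I_n}) := Z `&` block_points Z a x B.

Lemma block_eq B B' i : B \in P -> B' \in P -> i \in B -> i \in B' -> B = B'.
Proof.
have [/and3P[_ triv _] _] := nc.
by move=> BP BP' iB iB'; rewrite -(def_pblock triv BP iB) (def_pblock triv BP' iB').
Qed.

Lemma decoration_sector i : closure Z (x i) /\
  [\/ x i = a i, x i = a (ordS i) | sector i (x i)].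
Proof.
have [hs ha hn] := dec i.
have [/hs[cx [_ []]]|/hn {}hn] := pselect (singleton P i).
- by split=> //; constructor 1.
- by split=> //; constructor 3.
have [/ha[cx [_ []]]|/hn[cx xs]] := pselect (adjacency P i).
- by split=> //; constructor 2.
- by split=> //; constructor 3.
by split=> //; constructor 3.
Qed.

Lemma block_ptsP B p : block_pts B p <->
  Z p /\ exists2 i, i \in B & sector i p /\ (p = x i \/ cyc3 (a i) p (x i)).
Proof.
split=> [[Zp [i iB [_ [ax px]]]]|[Zp [i iB [si px]]]].
  split=> //; exists i => //; split=> //.
  have [cx hx] := decoration_sector i; have p1 := adm_unit adm Zp.
  have [||] : [\/ x i = a i, x i = a (ordS i) | sector i (x i)] := hx.
  - by move=> xE; case: ax.
  - move=> xE; case: px => [pE|]; last by rewrite xE.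
    by case: (@limit_notin _ _ _ _ adm (ordS i)); rewrite -xE -pE.
  - have := @limit_neqS i; move: px ax; rewrite /sector; circ.
split=> //; exists i => //; split; first by apply: subset_closure.
split=> // axE; case: px => [pE|].
  by case: (@limit_notin _ _ _ _ adm i); rewrite axE -pE.
have p1 := adm_unit adm Zp; rewrite -axE; circ.
Qed.

Lemma block_pts_disjoint B B' p : B \in P -> B' \in P ->
  block_pts B p -> block_pts B' p -> B = B'.
Proof.
move=> BP BP' /block_ptsP[Zp [i iB [si _]]] /block_ptsP[_ [j jB [sj _]]].
by apply: (block_eq BP BP' iB); rewrite (sector_unique si sj).
Qed.

(** If the four points lie in four different sectors, this is the non-crossing condition on their
    indices. Two points of one block in the same sector would enclose a point of the other block in
    that sector, and a common sector identifies the blocks. *)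
Lemma block_pts_noncrossing B B' p q r s : B \in P -> B' \in P ->
  block_pts B p -> block_pts B q -> block_pts B' r -> block_pts B' s ->
  cyc4 p r q s -> B = B'.
Proof.
move=> BP BP' /block_ptsP[Zp [i iB [si _]]] /block_ptsP[Zq [j jB [sj _]]].
move=> /block_ptsP[Zr [k kB [sk _]]] /block_ptsP[Zs [l lB [sl _]]] prqs.
have [ik|ik] := eqVneq i k; first by apply: (block_eq BP BP' iB); rewrite ik.
have [il|il] := eqVneq i l; first by apply: (block_eq BP BP' iB); rewrite il.
have [jk|jk] := eqVneq j k; first by apply: (block_eq BP BP' jB); rewrite jk.
have [jl|jl] := eqVneq j l; first by apply: (block_eq BP BP' jB); rewrite jl.
have between m p1 p2 p3 p4 : Z p1 -> Z p2 -> Z p3 -> Z p4 ->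
    sector m p1 -> sector m p3 -> cyc4 p1 p2 p3 p4 -> sector m p2 \/ sector m p4.
  by move=> Z1 Z2 Z3 Z4; rewrite /sector; circ.
have [ij|ij] := eqVneq i j.
  rewrite -ij in sj.
  have [/(sector_unique sk) ki|/(sector_unique sl) li] :=
    between _ _ _ _ _ Zp Zr Zq Zs si sj prqs.
    by rewrite ki eqxx in ik.
  by rewrite li eqxx in il.
have [kl|kl] := eqVneq k l.
  rewrite -kl in sl; have rqsp : cyc4 r q s p by case: prqs.
  have [/(sector_unique sj) jk'|/(sector_unique si) ik'] :=
    between _ _ _ _ _ Zr Zq Zs Zp sk sl rqsp.
    by rewrite jk' eqxx in jk.
  by rewrite ik' eqxx in ik.
have lt (m m' : 'I_n) p1 p2 : m != m' -> Z p1 -> Z p2 -> sector m p1 -> sector m' p2 ->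
    cyc3 (a i0) p1 p2 -> (m < m')%N.
  move=> mm' Z1 Z2 s1 s2 c12; rewrite ltn_neqAle mm' leqNgt; apply/negP => m'm.
  have := sector_lt m'm s2 s1; move: c12.
  by circ.
have [_ ncP] := nc.
(* The cut falls into one of the four gaps between the points; each gives a linear order of the
   indices, and in two of them the blocks exchange their roles. *)
have [[c1 [c2 c3]]|[[c1 [c2 c3]]|[[c1 [c2 c3]]|[c1 [c2 c3]]]]] :
    (cyc3 (a i0) p r /\ cyc3 (a i0) r q /\ cyc3 (a i0) q s) \/
    (cyc3 (a i0) r q /\ cyc3 (a i0) q s /\ cyc3 (a i0) s p) \/
    (cyc3 (a i0) q s /\ cyc3 (a i0) s p /\ cyc3 (a i0) p r) \/
    (cyc3 (a i0) s p /\ cyc3 (a i0) p r /\ cyc3 (a i0) r q).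
  have := sector_neq si; have := sector_neq sj; have := sector_neq sk.
  have := sector_neq sl; move: prqs.
  by circ.
- by apply: (ncP B B' BP BP' i k j l) => //; [apply: lt c1|apply: lt c2|apply: lt c3];
    rewrite // eq_sym.
- by apply/esym/(ncP B' B BP' BP k j l i) => //; [apply: lt c1|apply: lt c2|apply: lt c3];
    rewrite // eq_sym.
- by apply: (ncP B B' BP BP' j l i k) => //; [apply: lt c1|apply: lt c2|apply: lt c3];
    rewrite // eq_sym.
- by apply/esym/(ncP B' B BP' BP l i k j) => //; [apply: lt c1|apply: lt c2|apply: lt c3];
    rewrite // eq_sym.
Qed.

(** Since [Z] accumulates at [a i] on the anti-clockwise side, the predecessor of a point of (a_i,
    x_i] is still beyond [a i]. In terms of arcs this is the closure of the aisle under
    suspension. *)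
Lemma block_pts_pred B p : Z p -> block_pts B (succ_pt Z p) -> block_pts B p.
Proof.
move=> Zp /block_ptsP[Zs [i iB [si sx]]]; apply/block_ptsP; split=> //.
have [_ sp_neq sP] := succP adm Zp.
have nai : succ_pt Z p <> a i by move=> sE; apply: (@limit_notin _ _ _ _ adm i); rewrite -sE.
have npi : p <> a i by move=> pE; apply: (@limit_notin _ _ _ _ adm i); rewrite -pE.
have [v Zv av] := limit_after adm (adm_unit adm Zs) nai.
have pas : cyc3 (a i) p (succ_pt Z p).
  by move: av (sP v Zv) npi sp_neq; circ.
exists i => //; split; first by move: si pas; rewrite /sector; circ.
have cx : closure Z (x i) by case: (decoration_sector i).
by right; move: sx pas; circ.
Qed.

(** If [u] is not in the block, no interval (a_j, x_j] contains [u], so each one precedes its end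
    [x j] on the walk from [u], and the end at the largest angle from [u] is the maximum. *)
Lemma block_maxE u B : Z u -> B \in P -> (exists p, block_pts B p) ->
  exists p, block_points Z a x B p /\
    forall q, block_points Z a x B q -> Icc Z (succ_pt Z u) p q.
Proof.
move=> Zu BP [p0 [Zp0 [i1 i1B i1p]]].
have clos i q : Ioc Z (a i) (x i) q -> closure Z q by case.
have cx i : closure Z (x i) by case: (decoration_sector i).
have Zs := succ_in adm Zu.
have [uB|nuB] := pselect (block_points Z a x B u).
  exists u; split=> // q [i iB iq]; split; first exact: clos iq.
  have cq := clos _ _ iq; have [_ su _] := succP adm Zu.
  by have := closure_succ Zu cq; move: su; circ.
have u1 := adm_unit adm Zu; have x1 i := closure_unit adm (cx i).
have xu i : i \in B -> a i <> x i -> x i <> u.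
  move=> iB ax xE; apply: nuB; exists i => //; split; last by split=> //; left.
  exact: subset_closure.
pose good i := (i \in B) && `[< a i <> x i >].
have good1 : good i1 by rewrite /good i1B; apply/asboolP; case: i1p => _ [].
case: (arg_maxP (fun i => angle u (x i)) good1) => i /andP[iB /asboolP ax] imax.
have cxi := cx i; have xui := xu i iB ax.
exists (x i); split; first by exists i => //; split=> //; split=> //; left.
move=> q [j jB [cq [axj qj]]]; split=> //.
have cxj := cx j.
have ij : x j = x i \/ cyc3 u (x j) (x i).
  have /imax : good j by rewrite /good jB; apply/asboolP.
  rewrite /= le_eqVlt => /orP[/eqP/(angle_inj u1 (x1 j) (x1 i))|]; first by left.
  move=> ji; right; rewrite (cyc3E u1) // /cyc_lt angle_base // ji andbT.
  have [/andP[+ _] _] := angleP u1 (x1 j); rewrite le_eqVlt => /orP[/eqP u0|-> //].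
  case: (xu j jB axj); apply: (@angle_inj _ u) => //.
  by rewrite -u0 angle_base.
have au : u <> a j by move=> uE; apply: (@limit_notin _ _ _ _ adm j); rewrite -uE.
have uaj : ~ cyc3 (a j) u (x j).
  by move=> uj; apply: nuB; exists j => //; split; [exact: subset_closure|split=> //; right].
have [_ su _] := succP adm Zu.
have := closure_succ Zu cq; have := closure_succ Zu cxi.
have := xu j jB axj; move: su uaj au ij qj xui.
circ.
Qed.

(** The point at issue is that the maximum lies in [Z]. If it were a limit point, it would be x_i =
    a_(i+1), so [i] would be an adjacency; then i+1 is in the block as well, and the points of
    (a_(i+1), x_(i+1)] just after the supposed maximum exceed it. *)
Lemma block_maxP u B : Z u -> B \in P -> (exists p, block_pts B p) ->
  let z := block_max Z a x u B in
  [/\ block_pts B z, block_pts B u -> z = u & forall q, block_pts B q -> ~ cyc3 z q u].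
Proof.
move=> Zu BP Bne z; have [] := xgetPex u (block_maxE Zu BP Bne).
rewrite -/(block_max Z a x u B) -/z => -[i iB [cz [axi zi]]] zmax.
have Zs := succ_in adm Zu; have [_ su _] := succP adm Zu.
have zus := closure_succ Zu cz.
have cx k : closure Z (x k) by case: (decoration_sector k).
have Zz : Z z.
  apply: contrapT => nZz.
  have xaS : x i = a (ordS i).
    have [_ hx] := decoration_sector i.
    have [//|[k zk]] := (closure_adm adm z).1 cz.
    have nsz : ~ sector i z by rewrite zk; exact: limit_sector.
    have cxi := cx i.
    have [xE||sx] : [\/ x i = a i, x i = a (ordS i) | sector i (x i)] := hx.
    - by case: axi.
    - by [].
    - move: nsz zi sx; rewrite /sector; circ.
  have zE : z = a (ordS i).
    have [//|[k zk]] := (closure_adm adm z).1 cz.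
    case: zi => [zx|]; first by rewrite zx.
    by rewrite xaS zk => /limit_sector.
  set k := ordS i in zE xaS.
  have kB : k \in B.
    have [hs ha hn] := dec i.
    have [/hs[_ [_ xi]]|ns] := pselect (singleton P i).
      exfalso; case: xi => [xE|]; first by case: axi.
      by rewrite xaS /k; circ.
    have [[B' [BP' iB' kB']]|na] := pselect (adjacency P i).
      by rewrite (block_eq BP BP' iB iB').
    by exfalso; have [_] := hn ns na; rewrite xaS /k; circ.
  (* The index [k] shares its block with [i], so it is not a singleton and its interval is
     non-empty. *)
  have axk : a k <> x k.
    have [hs ha hn] := dec k; have aS := @limit_neqS k; have cxk := cx k.
    have ns : ~ singleton P k.
      move=> kP; have kE := block_eq BP kP kB (set11 k).
      by move: iB; rewrite kE inE => /eqP /esym; exact: neq_ordS.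
    have [/ha[_ [_ xk]]|/(hn ns)[_ xk]] := pselect (adjacency P k).
      by move: xk aS; circ.
    by move: xk; circ.
  have zu : z <> u by move=> zu; apply: nZz; rewrite zu.
  (* [w] is whichever of [x k] and [u] comes first after [a k]: points of [Z] before it are in the
     block and have not yet passed [u]. *)
  have [w [w1 wa wu]] : exists w, [/\ unit_circle w, w <> a k &
      forall v, Z v -> cyc3 (a k) v w -> cyc3 (a k) v (x k) /\ cyc3 (a k) v u].
    have cxk := cx k; have [xku|xku] := pselect (cyc3 (a k) (x k) u).
      exists (x k); split=> [||v Zv]; [circle_side|by move/esym|].
      by move: xku; circ.
    exists u; split=> [||v Zv]; [circle_side|by rewrite -zE; move/esym|].
    by move: xku axk; circ.
  have [v Zv /(wu _ Zv)[vx vu]] := limit_after adm w1 wa.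
  have vB : block_points Z a x B v.
    by exists k => //; split; [exact: subset_closure|split=> //; right].
  have [_ vI] := zmax v vB; rewrite -zE in vu.
  by move: vI vu zus su; circ.
split=> [|[_ /zmax[_ uI]]|q [Zq /zmax[_ qI]]]; first by split=> //; exists i.
  by move: uI zus su; circ.
by move: qI zus su; circ.
Qed.

End Decoration.
End Blocks.

(** * The arcs associated with T *)

Lemma set2_eq (T : Type) (p q y0 y1 : T) : y0 <> y1 ->
  [set p; q] = [set y0; y1] -> (p = y0 /\ q = y1) \/ (p = y1 /\ q = y0).
Proof.
move=> y01 pq; have hp : [set y0; y1] p by rewrite -pq; left.
have hq : [set y0; y1] q by rewrite -pq; right.
have h0 : [set p; q] y0 by rewrite pq; left.
have h1 : [set p; q] y1 by rewrite pq; right.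
case: hp hq => [pE|pE] [qE|qE]; [|by left|by right|].
- by case: y01; case: h1 => ->; rewrite ?pE ?qE.
- by case: y01; case: h0 => ->; rewrite ?pE ?qE.
Qed.

Section Arcs.
Variables (R : realType) (n : nat) (Z : set (R * R)) (a : 'I_n -> R * R).
Hypothesis adm : admissible Z a.
Implicit Types p q u v w z : R * R.

Lemma is_arcE p q : is_arc Z [set p; q] <->
  [/\ Z p, Z q, p <> q, q <> succ_pt Z p & p <> succ_pt Z q].
Proof.
have nontrivialE y0 y1 : nontrivial_pair Z y0 y1 <->
    [/\ Z y0, Z y1, y0 <> y1, y1 <> succ_pt Z y0 & y0 <> succ_pt Z y1].
  split=> [[Z0 Z1 n01]|[Z0 Z1 n01 ns0 ns1]].
    split=> // [y01|y1s|y0s]; apply: n01.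
    - by left; right.
    - by right.
    - by left; left; rewrite /= y0s (succK adm).
  split=> // -[[/= y1p|/= y1E]|/= //].
    by apply: ns1; rewrite y1p (predK adm).
  by apply: n01.
split=> [[y0 [y1 [/nontrivialE[Z0 Z1 n01 ns0 ns1]]]]|/nontrivialE pq].
  by move=> /(set2_eq n01)[[-> ->]|[-> ->]]; split=> //; apply/nesym.
by exists p, q.
Qed.

(** Points of [Z] on both sides of the pair prevent its ends from being equal or neighbours.
    Non-triviality of the pairs below is obtained from crossings in this way. *)
Lemma cross_is_arc p q w w' : Z p -> Z q -> Z w -> Z w' -> cross p q w w' ->
  is_arc Z [set p; q].
Proof.
move=> Zp Zq Zw Zw' pqw; apply/is_arcE.
have Zsp := succ_in adm Zp; have Zsq := succ_in adm Zq.
have [_ _ sp] := succP adm Zp; have [_ _ sq] := succP adm Zq.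
split=> //.
- by move: pqw; circ.
- by move: pqw (sp w Zw) (sp w' Zw'); circ.
- by move: pqw (sq w Zw) (sq w' Zw'); circ.
Qed.

Lemma succ_inj p q : Z p -> Z q -> succ_pt Z p = succ_pt Z q -> p = q.
Proof. by move=> Zp Zq pq; rewrite -(succK adm Zp) pq (succK adm). Qed.

Lemma is_arc_succ p q : is_arc Z [set p; q] ->
  is_arc Z [set succ_pt Z p; succ_pt Z q].
Proof.
move=> /is_arcE[Zp Zq pq qs ps].
have Zsp := succ_in adm Zp; have Zsq := succ_in adm Zq.
apply/is_arcE; split=> //.
- by move=> /(succ_inj Zp Zq)/pq.
- by move=> /(succ_inj Zq Zsp)/qs.
- by move=> /(succ_inj Zp Zsq)/ps.
Qed.

End Arcs.

(* [block_cut Z a x t bs j] and [block_cut Z a x t' bs j] are z_(j+1) and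
   z'_(j+1). *)
Definition block_cut (R : realType) (n : nat) (Z : set (R * R))
    (a x : 'I_n -> R * R) (u : R * R) (bs : seq {set 'I_n}) (j : nat) : R * R :=
  block_max Z a x u (nth finset.set0 bs j).

(* The arc of [T|_Y] between the j-th and the (j+1)-st crossing block has the
   ends [left_end j] and [right_end j], where t and t' play the roles of the
   points missing for j = 0 and j = l; for l = 0 this is the single arc T. *)
Definition left_end (R : realType) (n : nat) (Z : set (R * R))
    (a x : 'I_n -> R * R) (t t' : R * R) (bs : seq {set 'I_n}) (j : nat) : R * R :=
  if j is i.+1 then pred_pt Z (block_cut Z a x t' bs i) else t.

Definition right_end (R : realType) (n : nat) (Z : set (R * R))
    (a x : 'I_n -> R * R) (t t' : R * R) (bs : seq {set 'I_n}) (j : nat) : R * R :=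
  if (j < size bs)%N then pred_pt Z (block_cut Z a x t bs j) else t'.

(** Applied to the successors of the ends of an arc, this is membership of the arc in the coaisle.
    When [e] and [e'] are in [Z], a pair [v0], [v1] crossing them is an arc by [cross_is_arc]. *)
Definition uncrossed (R : realType) (n : nat) (Z : set (R * R))
    (a : 'I_n -> R * R) (P : {set {set 'I_n}}) (x : 'I_n -> R * R)
    (e e' : R * R) : Prop :=
  forall C v0 v1, C \in P -> block_pts Z a x C v0 -> block_pts Z a x C v1 ->
  ~ cross v0 v1 e e'.

Section Crossing.
Variables (R : realType) (n : nat) (Z : set (R * R)) (a : 'I_n -> R * R).
Hypothesis n_ge2 : (2 <= n)%N.
Hypothesis adm : admissible Z a.
Variables (P : {set {set 'I_n}}) (x : 'I_n -> R * R).
Hypothesis nc : noncrossing_partition P.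
Hypothesis dec : decoration Z a P x.
Variables (t t' : R * R) (bs : seq {set 'I_n}).
Hypothesis tt'_arc : is_arc Z [set t; t'].
Hypothesis bsP : crossing_blocks Z a P x t t' bs.
Implicit Types (p q u v w : R * R) (B : {set 'I_n}) (i j k : nat).

Local Notation Q := (block_pts Z a x).
Local Notation B := (nth finset.set0 bs).
Local Notation z := (block_cut Z a x t bs).
Local Notation z' := (block_cut Z a x t' bs).
Local Notation lend := (left_end Z a x t t' bs).
Local Notation rend := (right_end Z a x t t' bs).
Local Notation uncrossed := (uncrossed Z a P x).
Local Notation succ := (succ_pt Z).
Local Notation pred := (pred_pt Z).

Let Zt : Z t. Proof. by case/(is_arcE adm): tt'_arc. Qed.
Let Zt' : Z t'. Proof. by case/(is_arcE adm): tt'_arc. Qed.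
Let Zst : Z (succ t). Proof. exact: (succ_in adm). Qed.
Let Zst' : Z (succ t'). Proof. exact: (succ_in adm). Qed.
Let tt' : t <> t'. Proof. by case/(is_arcE adm): tt'_arc. Qed.
Let t'st : t' <> succ t. Proof. by case/(is_arcE adm): tt'_arc. Qed.
Let tst' : t <> succ t'. Proof. by case/(is_arcE adm): tt'_arc. Qed.
Let st : succ t <> t. Proof. by case: (succP adm Zt). Qed.
Let st' : succ t' <> t'. Proof. by case: (succP adm Zt'). Qed.

Let sep u v : Z u -> Z v -> ~ cyc3 u v (succ u).
Proof. by move=> Zu; case: (succP adm Zu) => _ _; apply. Qed.

Let QZ C p : Q C p -> Z p. Proof. by case. Qed.
Local Hint Resolve QZ : circle.

Let Q_pred C p : Q C p -> Q C (pred p).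
Proof.
move=> Qp; have Zp := QZ Qp; apply: (block_pts_pred n_ge2 adm dec).
  exact: (pred_in adm).
by rewrite (predK adm).
Qed.

Let Q_succ C p : Z p -> Q C (succ p) -> Q C p.
Proof. exact: (block_pts_pred n_ge2 adm dec). Qed.

Let pred_between p q : Z p -> Z q -> p <> q -> q <> succ p -> cyc3 p (pred q) q.
Proof.
move=> Zp Zq pq qsp; have [Zpq pqq pqs] := predP adm Zq.
have ppq : pred q <> p by move=> pqE; apply: qsp; rewrite -pqE (predK adm).
by move: (pqs p Zp) pqq pq ppq; circ.
Qed.

(** * The order of the points z_i and z_i' around T *)

Lemma crossing_blockE C : C \in P -> block_crosses Z a x C t t' <->
  exists v0 v1, [/\ Q C v0, Q C v1, cyc3 t v0 t' & cyc3 t' v1 t].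
Proof.
move=> CP; split=> [[v0 [v1 [/(is_arcE adm)[Z0 Z1 _ _ _] C0 C1 v01]]]|].
  have [?|?] : cyc3 t v0 t' /\ cyc3 t' v1 t \/ cyc3 t v1 t' /\ cyc3 t' v0 t.
    by move: v01; circ.
    by exists v0, v1; split; [split|split| |]; tauto.
  by exists v1, v0; split; [split|split| |]; tauto.
move=> [v0 [v1 [[Z0 C0] [Z1 C1] tv0 tv1]]]; exists v0, v1.
have v01 : cross v0 v1 t t' by move: tv0 tv1; circ.
by split=> //; exact: (cross_is_arc adm Z0 Z1 Zt Zt' v01).
Qed.

Lemma crossing_nth j : (j < size bs)%N -> B j \in P /\
  exists v0 v1, [/\ Q (B j) v0, Q (B j) v1, cyc3 t v0 t' & cyc3 t' v1 t].
Proof.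
move=> jl; have [_ /(_ (B j))[/(_ (mem_nth _ jl))[BP +] _] _ _] := bsP.
by move=> /(crossing_blockE BP).
Qed.

Lemma crossing_complete C v0 v1 : C \in P -> Q C v0 -> Q C v1 ->
  v0 = t' \/ cyc3 t v0 t' -> v1 = t \/ cyc3 t' v1 t ->
  v0 <> succ t -> v1 <> succ t' -> exists2 j, (j < size bs)%N & C = B j.
Proof.
move=> CP C0 C1 h0 h1 n0 n1.
have [w0 Cw0 tw0] : exists2 w0, Q C w0 & cyc3 t w0 t'.
  case: h0 => [v0E|]; last by exists v0.
  by exists (pred v0); [exact: Q_pred|rewrite v0E; exact: pred_between].
have [w1 Cw1 tw1] : exists2 w1, Q C w1 & cyc3 t' w1 t.
  case: h1 => [v1E|]; last by exists v1.
  exists (pred v1); [exact: Q_pred|rewrite v1E; apply: pred_between => //].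
  exact/nesym.
have /(nthP finset.set0)[j jl <-] : C \in bs.
  by have [_ -> _ _] := bsP; split=> //; apply/(crossing_blockE CP); exists w0, w1.
by exists j.
Qed.

Lemma crossing_maxP j : (j < size bs)%N ->
  [/\ Q (B j) (z j), Q (B j) (z' j), z j = t \/ cyc3 t' (z j) t
    & z' j = t' \/ cyc3 t (z' j) t'].
Proof.
move=> jl; have [BP [v0 [v1 [Q0 Q1 tv0 tv1]]]] := crossing_nth jl.
have Bne : exists p, Q (B j) p by exists v0.
have [Qz _ zmax] := block_maxP n_ge2 adm nc dec Zt BP Bne.
have [Qz' _ z'max] := block_maxP n_ge2 adm nc dec Zt' BP Bne.
have Zz := QZ Qz; have Zz' := QZ Qz'.
have Z0 := QZ Q0; have Z1 := QZ Q1.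
by split=> //; [move: (zmax _ Q1) tv1|move: (z'max _ Q0) tv0]; rewrite -/(z j) -/(z' j); circ.
Qed.

Lemma crossing_max j q : (j < size bs)%N -> Q (B j) q ->
  [/\ ~ cyc3 (z j) q t, q = t -> z j = t, ~ cyc3 (z' j) q t' & q = t' -> z' j = t'].
Proof.
move=> jl Qq; have [BP _] := crossing_nth jl.
have Bne : exists p, Q (B j) p by exists q.
have [Qz zt zmax] := block_maxP n_ge2 adm nc dec Zt BP Bne.
have [Qz' zt' z'max] := block_maxP n_ge2 adm nc dec Zt' BP Bne.
split; [exact: zmax|move=> qt; apply: zt; by rewrite -qt|exact: z'max|].
by move=> qt; apply: zt'; rewrite -qt.
Qed.

Lemma crossing_inj i j : (i < size bs)%N -> (j < size bs)%N -> B i = B j -> i = j.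
Proof. by move=> il jl; have [u _ _ _] := bsP => /eqP; rewrite nth_uniq // => /eqP. Qed.

Lemma crossing_noncrossing i j p q r s : (i < size bs)%N -> (j < size bs)%N ->
  i <> j -> Q (B i) p -> Q (B i) q -> Q (B j) r -> Q (B j) s -> ~ cyc4 p r q s.
Proof.
move=> il jl ij Qp Qq Qr Qs prqs; apply: ij; apply: crossing_inj => //.
have [[iP _] [jP _]] := (crossing_nth il, crossing_nth jl).
exact: (block_pts_noncrossing n_ge2 adm nc dec iP jP Qp Qq Qr Qs).
Qed.

Lemma crossing_z_lt i j : (i < j < size bs)%N -> cyc3 t' (z j) (z i).
Proof.
have [_ _ _ zS] := bsP; elim: j => [|j IH] /andP[]; first by rewrite ltn0.
move=> ij jl; have [Qj _ _ _] := crossing_maxP jl; have Zj := QZ Qj.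
have [Qj' _ _ _] := crossing_maxP (ltnW jl); have Zj' := QZ Qj'.
have := zS j jl; rewrite -/(z j) -/(z j.+1).
move: ij; rewrite ltnS leq_eqVlt => /orP[/eqP -> //|ij].
have [Qi _ _ _] := crossing_maxP (ltn_trans ij (ltnW jl)); have Zi := QZ Qi.
by have := IH _; rewrite ij ltnW // => /(_ isT); circ.
Qed.

(** The chords {z_i, z_i'} and {z_j, z_j'} belong to different blocks and cannot cross, so the order
    on one side of T is mirrored on the other: the two descriptions of the numbering agree. *)
Lemma crossing_z'_lt i j : (i < j < size bs)%N -> cyc3 t (z' i) (z' j).
Proof.
move=> ij; have zji := crossing_z_lt ij; case/andP: ij => ij jl.
have il := ltn_trans ij jl; have ij' : i <> j by lia.
have [Qi Qi' hi hi'] := crossing_maxP il; have [Qj Qj' hj hj'] := crossing_maxP jl.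
have Zi := QZ Qi; have Zi' := QZ Qi'; have Zj := QZ Qj; have Zj' := QZ Qj'.
have z'ij : z' i <> z' j.
  move=> zE; apply: ij'; apply: crossing_inj => //; rewrite -zE in Qj'.
  have [[iP _] [jP _]] := (crossing_nth il, crossing_nth jl).
  exact: (block_pts_disjoint n_ge2 adm nc dec iP jP Qi' Qj').
have := crossing_noncrossing il jl ij' Qi' Qi Qj' Qj.
have := crossing_noncrossing il jl ij' Qi Qi' Qj' Qj.
move: zji z'ij hi hi' hj hj' tt'.
circ.
Qed.


(** * Arcs of the aisle against T and the chords {z_i', z_i} *)

Lemma aisle_arc_factors C y0 y1 : C \in P -> Q C y0 -> Q C y1 ->
  cyc4 y0 (succ t') y1 (succ t) ->
  exists j, [/\ (j < size bs)%N, is_arc Z [set z' j; z j],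
                Icc Z y0 t' (z' j) & Icc Z y1 t (z j)].
Proof.
move=> CP C0 C1 y01; have Z0 := QZ C0; have Z1 := QZ C1.
(* Crossing {t^+, t'^+} instead of T admits the ends [t], [t'] and rules out their successors, which
   is the form that [crossing_complete] expects. *)
have h0 : y0 = t' \/ cyc3 t y0 t'.
  by move: y01 (sep Zt Z0) (sep Zt' Z0) (sep Zt Zt') (sep Zt' Zt) tt' st st' t'st tst'; circ.
have h1 : y1 = t \/ cyc3 t' y1 t.
  by move: y01 (sep Zt Z1) (sep Zt' Z1) (sep Zt Zt') (sep Zt' Zt) tt' st st' t'st tst'; circ.
have n0 : y0 <> succ t by move: y01; circ.
have n1 : y1 <> succ t' by move: y01; circ.
have [j jl CE] := crossing_complete CP C0 C1 h0 h1 n0 n1; subst C.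
have [Qz Qz' hz hz'] := crossing_maxP jl; have Zz := QZ Qz; have Zz' := QZ Qz'.
have [_ _ m0 m0'] := crossing_max jl C0; have [m1 m1' _ _] := crossing_max jl C1.
have I0 : z' j = y0 \/ z' j = t' \/ cyc3 y0 (z' j) t'.
  by move: h0 hz' m0 m0' tt'; circ.
have I1 : z j = y1 \/ z j = t \/ cyc3 y1 (z j) t.
  by move: h1 hz m1 m1' tt'; circ.
exists j; split=> //.
- apply: (cross_is_arc adm Zz' Zz Zst Zst'); right.
  have c0 : cyc3 (succ t) (z' j) (succ t').
    by move: I0 y01 (sep Zt Z0) (sep Zt' Z0) h0 st'; circ.
  have c1 : cyc3 (succ t') (z j) (succ t).
    by move: I1 y01 (sep Zt Z1) (sep Zt' Z1) h1 st; circ.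
  by move: c0 c1; circ.
- by split; first exact: subset_closure.
- by split; first exact: subset_closure.
Qed.

(** Separating the successors of [z' j] and [z j], the arc either has an end in common with the
    chord or crosses it; both put it into the block [B j]. As this block has no points between [z j]
    and [t] or between [z' j] and [t'], the arc also crosses {t^+, t'^+}. *)
Lemma aisle_arc_unique C y0 y1 j : C \in P -> Q C y0 -> Q C y1 ->
  (j < size bs)%N -> cyc4 y0 (succ (z' j)) y1 (succ (z j)) ->
  C = B j /\ cyc4 y0 (succ t') y1 (succ t).
Proof.
move=> CP C0 C1 jl y01; have Z0 := QZ C0; have Z1 := QZ C1.
have [Qz Qz' hz hz'] := crossing_maxP jl; have Zz := QZ Qz; have Zz' := QZ Qz'.
have [BP _] := crossing_nth jl.
have Zsz := succ_in adm Zz; have Zsz' := succ_in adm Zz'.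
have [_ sz _] := succP adm Zz; have [_ sz' _] := succP adm Zz'.
have CE : C = B j.
  have [y0z|y0z] := pselect (y0 = z' j).
    by apply: (block_pts_disjoint n_ge2 adm nc dec CP BP C0); rewrite y0z.
  have [y1z|y1z] := pselect (y1 = z j).
    by apply: (block_pts_disjoint n_ge2 adm nc dec CP BP C1); rewrite y1z.
  apply: (block_pts_noncrossing n_ge2 adm nc dec CP BP C0 C1 Qz' Qz).
  move: y01 y0z y1z (sep Zz Z0) (sep Zz' Z0) (sep Zz Z1) (sep Zz' Z1) sz sz'.
  by circ.
split=> //; subst C.
have [m0 m0' _ _] := crossing_max jl C0; have [_ _ m1 m1'] := crossing_max jl C1.
(* With [succ t] the block contains [t], so [z j] is [t]; but [y0] is strictly beyond [succ (z j)].
   This excludes the boundary value [succ t]. *)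
have s0 : y0 = succ t -> z j = t.
  by move=> y0E; rewrite y0E in C0; have [_ /(_ erefl)] := crossing_max jl (Q_succ Zt C0).
have s1 : y1 = succ t' -> z' j = t'.
  by move=> y1E; rewrite y1E in C1; have [_ _ _ /(_ erefl)] := crossing_max jl (Q_succ Zt' C1).
have k0 : y0 = z' j \/ cyc3 (z j) y0 (z' j).
  by move: y01 (sep Zz Z0) (sep Zz' Z0) (sep Zz Z1) (sep Zz' Z1) (sep Zz Zz') (sep Zz' Zz) sz sz'; circ.
have k1 : y1 = z j \/ cyc3 (z' j) y1 (z j).
  by move: y01 (sep Zz Z0) (sep Zz' Z0) (sep Zz Z1) (sep Zz' Z1) (sep Zz Zz') (sep Zz' Zz) sz sz'; circ.
have l0 : cyc3 (succ t) y0 (succ t').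
  have e0 : z j = t -> y0 <> succ t by move=> zE; move: y01; rewrite zE; circ.
  have [zt|zt] := pselect (y0 = succ t); first by case: e0 => //; exact: s0.
  have w0 : y0 = t' \/ cyc3 t y0 t'.
    move: k0 hz hz' m0 m0' tt'; circ.
  by move: w0 zt (sep Zt Z0) (sep Zt' Z0) (sep Zt Zt') (sep Zt' Zt) tt' st st' t'st tst'; circ.
have l1 : cyc3 (succ t') y1 (succ t).
  have e1 : z' j = t' -> y1 <> succ t' by move=> zE; move: y01; rewrite zE; circ.
  have [zt|zt] := pselect (y1 = succ t'); first by case: e1 => //; exact: s1.
  have w1 : y1 = t \/ cyc3 t' y1 t.
    move: k1 hz hz' m1 m1' tt'; circ.
  by move: w1 zt (sep Zt Z1) (sep Zt' Z1) (sep Zt Zt') (sep Zt' Zt) tt' st st' t'st tst'; circ.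
by move: l0 l1; circ.
Qed.

(** * Arcs of the coaisle against T and the arcs between consecutive chords *)

Let lendE j : (j <= size bs)%N ->
  (j = 0%N /\ lend j = t) \/
  exists i, [/\ j = i.+1, (i < size bs)%N, Q (B i) (lend j) & succ (lend j) = z' i].
Proof.
case: j => [|i] il; [by left|right; exists i].
have [_ Qz' _ _] := crossing_maxP il.
by split=> //; [exact: Q_pred|exact: (predK adm (QZ Qz'))].
Qed.

Let rendE j : (j <= size bs)%N ->
  (j = size bs /\ rend j = t') \/
  [/\ (j < size bs)%N, Q (B j) (rend j) & succ (rend j) = z j].
Proof.
rewrite leq_eqVlt /right_end => /orP[/eqP ->|jl]; first by left; rewrite ltnn.
right; rewrite jl; have [Qz _ _ _] := crossing_maxP jl.
by split=> //; [exact: Q_pred|exact: (predK adm (QZ Qz))].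
Qed.

Let lend_in j : (j <= size bs)%N -> Z (lend j) /\ (lend j = t \/ cyc3 t (lend j) t').
Proof.
move=> /lendE[[_ ->]|[i [_ il Qi si]]]; first by split=> //; left.
have Zi := QZ Qi; have Zsi := succ_in adm Zi; split=> //.
have [_ _ _ +] := crossing_maxP il; rewrite -si.
have [_ sn _] := succP adm Zi.
by move: (sep Zi Zt) (sep Zi Zt') sn tt'; circ.
Qed.

Let rend_in j : (j <= size bs)%N -> Z (rend j) /\ (rend j = t' \/ cyc3 t' (rend j) t).
Proof.
move=> /rendE[[_ ->]|[jl Qj sj]]; first by split=> //; left.
have Zj := QZ Qj; have Zsj := succ_in adm Zj; split=> //.
have [_ _ + _] := crossing_maxP jl; rewrite -sj.
have [_ sn _] := succP adm Zj.
by move: (sep Zj Zt) (sep Zj Zt') sn tt'; circ.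
Qed.

Let uncrossedC e e' : uncrossed e e' -> uncrossed e' e.
Proof. by move=> unc C v0 v1 CP C0 C1 [?|?]; apply: (unc C v0 v1) => //; [right|left]. Qed.

(** The index [j] counts the points [z i] met before d1^+ on the clockwise walk from [t]. The last
    of these chords is not crossed by {d0^+, d1^+}, so its other end [z' i] does not lie beyond
    d0^+; hence [lend j] is in [t, d0]. The next [z j] is not beyond d1^+ as seen from [t'], hence
    [rend j] is in [t', d1]. *)
Lemma coaisle_arc_factors d0 d1 : is_arc Z [set d0; d1] ->
  uncrossed (succ d0) (succ d1) -> cyc4 t (succ d0) t' (succ d1) ->
  exists j, [/\ (j <= size bs)%N, is_arc Z [set lend j; rend j],
                Icc Z t d0 (lend j) & Icc Z t' d1 (rend j)].
Proof.
move=> d_arc unc c; have [Z0 Z1 _ _ _] := (is_arcE adm _ _).1 d_arc.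
have Zs0 := succ_in adm Z0; have Zs1 := succ_in adm Z1.
have [_ sn0 _] := succP adm Z0; have [_ sn1 _] := succP adm Z1.
pose far i := cyc3 (succ d1) (z i) t \/ z i = t.
have [j [jl jleft jright]] : exists j, [/\ (j <= size bs)%N,
    forall i, j = i.+1 -> far i & (j < size bs)%N -> ~ far j].
  (* Upward search for the first index that is not [far]. Only the two chords adjacent to the gap
     [j] matter, so [far] is recorded for the index just before it alone. *)
  suff : forall m, (m <= size bs)%N -> (forall i, m = i.+1 -> far i) ->
      exists j, [/\ (j <= size bs)%N,
        forall i, j = i.+1 -> far i & (j < size bs)%N -> ~ far j].
    by move=> h; apply: (h 0%N).
  move=> m; move mE: (size bs - m)%N => k; elim: k m mE => [|k IH] m mE ml mfar.
    by exists m; split=> //; lia.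
  have [fm|nfm] := pselect (far m); last by exists m; split.
  by apply: (IH m.+1); [lia|lia|move=> i [<-]].
exists j; have [ZL hL] := lend_in jl; have [ZR hR] := rend_in jl.
have IL : lend j = t \/ lend j = d0 \/ cyc3 t (lend j) d0.
  have [[_ ->]|[i [jE il Qi si]]] := lendE jl; first by left.
  have fi := jleft i jE; have [Qz Qz' hz hz'] := crossing_maxP il.
  have Zz := QZ Qz; have Zz' := QZ Qz'; have [iP _] := crossing_nth il.
  have hz'2 : z' i = succ d0 \/ cyc3 t (z' i) (succ d0).
    have := unc _ _ _ iP Qz' Qz; move: fi c hz'; rewrite /far.
    by circ.
  have [_ sL _] := succP adm ZL; rewrite -si in hz'2.
  have ZsL := succ_in adm ZL.
  have [LE|LE] := pselect (succ (lend j) = succ d0).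
    by right; left; apply: (succ_inj adm ZL Z0 LE).
  move: hL hz'2 LE c (sep Z0 ZL) (sep Z0 Zt) (sep ZL Zt) (sep ZL Z0) sn0 sL.
  by circ.
have IR : rend j = t' \/ rend j = d1 \/ cyc3 t' (rend j) d1.
  have [[_ ->]|[jl' Qj sj]] := rendE jl; first by left.
  have nfj := jright jl'; have [Qz _ hz _] := crossing_maxP jl'; have Zz := QZ Qz.
  have [_ sR _] := succP adm ZR; have ZsR := succ_in adm ZR.
  have hz2 : succ (rend j) = succ d1 \/ cyc3 t' (succ (rend j)) (succ d1).
    by rewrite sj; move: nfj hz c; rewrite /far; circ.
  have [RE|RE] := pselect (succ (rend j) = succ d1).
    by right; left; apply: (succ_inj adm ZR Z1 RE).
  move: hR hz2 RE c (sep Z1 ZR) (sep Z1 Zt') (sep ZR Zt') (sep ZR Z1) sn1 sR.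
  by circ.
split=> //.
- apply: (cross_is_arc adm ZL ZR Zs0 Zs1); left.
  have c0 : cyc3 (succ d1) (lend j) (succ d0).
    by move: IL c (sep Z0 Zt) sn0; circ.
  have c1 : cyc3 (succ d0) (rend j) (succ d1).
    by move: IR c (sep Z1 Zt') sn1; circ.
  by move: c0 c1; circ.
- by split; first exact: subset_closure.
- by split; first exact: subset_closure.
Qed.

Let lend_lt j : (j < size bs)%N -> lend j = t \/ cyc3 t (lend j) (z' j).
Proof.
move=> jl; have [ZL hL] := lend_in (ltnW jl).
have [[_ ->]|[i [jE il Qi si]]] := lendE (ltnW jl); first by left.
have [_ Qj _ _] := crossing_maxP jl; have Zj := QZ Qj.
have ij : (i < j < size bs)%N by rewrite jE ltnSn -jE.
have [_ sn _] := succP adm ZL; have ZsL := succ_in adm ZL.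
have := crossing_z'_lt ij; rewrite -si; move: (sep ZL Zj) (sep ZL Zt) sn hL.
by circ.
Qed.

Let rend_lt i : (i.+1 <= size bs)%N ->
  rend i.+1 = t' \/ cyc3 t' (rend i.+1) (z i).
Proof.
move=> il; have [ZR hR] := rend_in il.
have [[_ ->]|[jl Qj sj]] := rendE il; first by left.
have [Qi _ _ _] := crossing_maxP il; have Zi := QZ Qi.
have ij : (i < i.+1 < size bs)%N by rewrite ltnSn.
have [_ sn _] := succP adm ZR; have ZsR := succ_in adm ZR.
have := crossing_z_lt ij; rewrite -sj; move: (sep ZR Zi) (sep ZR Zt') sn hR.
by circ.
Qed.

(** A pair crossing {lend j, rend j} but not the adjacent chords is confined to the gap between
    them, which also places its ends on different sides of T. On the side from [t'] to [t], the end
    [e] lies in a half-open interval that starts at [z j] and stops before the preceding [z i]. *)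
Lemma coaisle_arc_position j e e' : (j <= size bs)%N -> is_arc Z [set e; e'] ->
  uncrossed e e' -> cyc4 (lend j) e' (rend j) e ->
  [/\ cyc3 t e' t', cyc3 t' e t, forall i, j = i.+1 -> cyc3 t' e (z i)
    & (j < size bs)%N -> e = z j \/ cyc3 t' (z j) e].
Proof.
move=> jl /(is_arcE adm)[Ze Ze' ee' e's es] unc c.
have [ZL hL] := lend_in jl; have [ZR hR] := rend_in jl.
have he i : j = i.+1 -> cyc3 t' e (z i).
  move=> jE; have [[j0 _]|[i' [jE' il Qi si]]] := lendE jl; first by rewrite j0 in jE.
  have ii' : i' = i by move: jE; rewrite jE' => -[].
  subst i'; have [Qz _ hz _] := crossing_maxP il; have Zz := QZ Qz.
  have [iP _] := crossing_nth il; have Zpz := pred_in adm Zz.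
  have hR2 : rend j = t' \/ cyc3 t' (rend j) (z i).
    by rewrite jE; apply: rend_lt; rewrite -jE.
  (* If [e] were [z i], the block of [z i] would also contain [pred e] and [lend j], and the chord
     joining these two would cross {e, e'}. *)
  have zne : z i <> e.
    move=> zE; have := unc _ _ _ iP Qi (Q_pred Qz); rewrite zE.
    have Zpe := pred_in adm Ze; have := pred_between Ze' Ze (nesym ee') es.
    by move: c; circ.
  by have := unc _ _ _ iP Qi Qz; move: hL hR hz hR2 zne c; circ.
have he' : cyc3 t e' t'.
  have [[_ rE]|[jl' Qj sj]] := rendE jl; first by move: c hL; rewrite rE; circ.
  have [_ Qz _ hz] := crossing_maxP jl'; have Zz := QZ Qz.
  have [jP _] := crossing_nth jl'; have Zpz := pred_in adm Zz.
  have hL2 := lend_lt jl'.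
  have zne : z' j <> e'.
    move=> zE; have := unc _ _ _ jP Qj (Q_pred Qz); rewrite zE.
    have Zpe := pred_in adm Ze'; have := pred_between Ze Ze' ee' e's.
    by move: c; circ.
  by have := unc _ _ _ jP Qj Qz; move: hL hR hz hL2 zne c; circ.
have het : cyc3 t' e t.
  have [[_ lE]|[i [jE il _ _]]] := lendE jl; first by move: c hR; rewrite lE; circ.
  have [Qz _ hz _] := crossing_maxP il; have Zz := QZ Qz.
  by move: (he i jE) hz; circ.
split=> // jl'; have [[jE _]|[_ _ sj]] := rendE jl.
  by move: jl'; rewrite jE ltnn.
have ZsR := succ_in adm ZR; rewrite -sj.
have [_ sn _] := succP adm ZR.
by move: (sep ZR Ze) (sep ZR Zt') (sep ZR Zt) sn hL hR het c; circ.
Qed.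

(** The half-open intervals that confine [e] are disjoint for different gaps. A crossing in the
    opposite orientation would move [e] to the other side of T. *)
Lemma coaisle_arc_unique j k e e' : (j <= size bs)%N -> (k <= size bs)%N ->
  is_arc Z [set e; e'] -> uncrossed e e' ->
  cross (lend j) (rend j) e e' -> cross (lend k) (rend k) e e' -> j = k.
Proof.
wlog c : e e' / cyc4 (lend j) e' (rend j) e => [ih|].
  move=> jl kl ee' unc cj ck; case: (cj) => cj'; last by apply: (ih e e').
  apply: (ih e' e) => //; first by rewrite setUC.
  - exact: uncrossedC.
  - by case: cj; [right|left].
  - by case: ck; [right|left].
move=> jl kl ee' unc _ ck.
have nlt i m : (i <= size bs)%N -> (m <= size bs)%N ->
    cyc4 (lend i) e' (rend i) e -> cyc4 (lend m) e' (rend m) e -> ~ (i < m)%N.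
  move=> il ml ci cm im; case: m => // m in ml cm im *.
  have [_ _ _ /(_ (leq_trans im ml)) hi] := coaisle_arc_position il ee' unc ci.
  have [_ _ /(_ m erefl) hm _] := coaisle_arc_position ml ee' unc cm.
  have [Qz _ _ _] := crossing_maxP (leq_trans im ml); have Zi := QZ Qz.
  have [Qm _ _ _] := crossing_maxP ml; have Zm := QZ Qm.
  have [Ze _ _ _ _] := (is_arcE adm _ _).1 ee'.
  have zim : z i = z m \/ cyc3 t' (z m) (z i).
    move: im; rewrite ltnS leq_eqVlt => /orP[/eqP ->|im]; first by left.
    by right; apply: crossing_z_lt; rewrite im.
  by move: zim hi hm; circ.
have {}ck : cyc4 (lend k) e' (rend k) e.
  case: ck => // ck.
  have [h1 h2 _ _] := coaisle_arc_position jl ee' unc c.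
  have [||h3 h4 _ _] := coaisle_arc_position (e := e') (e' := e) kl _ _ ck.
  - by rewrite setUC.
  - exact: uncrossedC.
  have [Ze Ze' _ _ _] := (is_arcE adm _ _).1 ee'.
  by exfalso; move: h1 h4; circ.
by have := nlt _ _ jl kl c ck; have := nlt _ _ kl jl ck c; lia.
Qed.

Lemma coaisle_arc_cross j e e' : (j <= size bs)%N ->
  is_arc Z [set e; e'] -> uncrossed e e' ->
  cross (lend j) (rend j) e e' -> cross t t' e e'.
Proof.
move=> jl ee' unc; have [Ze Ze' _ _ _] := (is_arcE adm _ _).1 ee'.
case=> c.
  have [||] := coaisle_arc_position (e := e') (e' := e) jl _ _ c.
  - by rewrite setUC.
  - exact: uncrossedC.
  by move=> + + _ _; circ.
by have [] := coaisle_arc_position jl ee' unc c; move=> + + _ _; circ.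
Qed.

(** The successors of the two ends are cuts z_i', z_j of the adjacent blocks, or t^+ or t'^+ at the
    extreme gaps. A block C crossing this pair is not an adjacent block, because the cuts are
    maximal. Held in place by the adjacent chords, it would have to cross T, and so be listed in
    [bs] at a position for which there is no room. *)
Lemma coaisle_arc_uncrossed j : (j <= size bs)%N ->
  is_arc Z [set lend j; rend j] -> uncrossed (succ (lend j)) (succ (rend j)).
Proof.
move=> jl LR_arc.
have [ZL hL] := lend_in jl; have [ZR hR] := rend_in jl.
have ZsL := succ_in adm ZL; have ZsR := succ_in adm ZR.
have [_ snL _] := succP adm ZL; have [_ snR _] := succP adm ZR.
have [_ _ LR RsL LsR] := (is_arcE adm _ _).1 LR_arc.
suff main C v0 v1 : C \in P -> Q C v0 -> Q C v1 ->
    ~ cyc4 v0 (succ (rend j)) v1 (succ (lend j)).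
  move=> C v0 v1 CP C0 C1; have := main C v0 v1 CP C0 C1.
  have := main C v1 v0 CP C1 C0; have Z0 := QZ C0; have Z1 := QZ C1.
  by circ.
move=> CP C0 C1 c; have Z0 := QZ C0; have Z1 := QZ C1.
have hsL : succ (lend j) = succ t \/ cyc3 (succ t) (succ (lend j)) t' \/ succ (lend j) = t'.
  case: hL => [->|tL]; first by left.
  by right; move: tL LR snL st tt' t'st (sep ZL Zt') (sep ZL Zt) (sep Zt ZL) (sep Zt ZsL); circ.
have hsR : succ (rend j) = succ t' \/ cyc3 (succ t') (succ (rend j)) t \/ succ (rend j) = t.
  case: hR => [->|tR]; first by left.
  by right; move: tR LR snR st' tt' tst' (sep ZR Zt') (sep ZR Zt) (sep Zt' ZR) (sep Zt' ZsR); circ.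
have neq_left i : j = i.+1 -> C <> B i.
  move=> jE CE; have [[j0 _]|[i' [jE' il Qi si]]] := lendE jl; first by rewrite j0 in jE.
  have ii' : i' = i by move: jE; rewrite jE' => -[].
  subst i' C; have [Qz Qz' hz hz'] := crossing_maxP il; have Zz := QZ Qz; have Zz' := QZ Qz'.
  have [_ _ m m'] := crossing_max il C0.
  have [[_ rE]|[jl' Qj sj]] := rendE jl.
    by move: c m m'; rewrite -si rE; move: hsL (sep Zt' Z0) (sep Zt Zt'); circ.
  have [Qy Qy' hy hy'] := crossing_maxP jl'; have Zy := QZ Qy; have Zy' := QZ Qy'.
  have ij : (i < j < size bs)%N by rewrite jl' jE ltnSn.
  have nij : i <> j by lia.
  have := crossing_noncrossing il jl' nij C0 Qz Qy Qy'.
  have := crossing_z_lt ij; have := crossing_z'_lt ij.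
  by move: c hz hz' hy hy' m m'; rewrite -si -sj; circ.
have neq_right : (j < size bs)%N -> C <> B j.
  move=> jl' CE; have [[jE _]|[_ Qj sj]] := rendE jl; first by move: jl'; rewrite jE ltnn.
  subst C; have [Qz Qz' hz hz'] := crossing_maxP jl'; have Zz := QZ Qz; have Zz' := QZ Qz'.
  have [m m' _ _] := crossing_max jl' C1.
  have [[_ lE]|[i [jE il Qi si]]] := lendE jl.
    by move: c m m'; rewrite -sj lE; move: hsR (sep Zt Z1) (sep Zt' Zt); circ.
  have [Qy Qy' hy hy'] := crossing_maxP il; have Zy := QZ Qy; have Zy' := QZ Qy'.
  have ij : (i < j < size bs)%N by rewrite jl' jE ltnSn.
  have nij : i <> j by lia.
  have := crossing_noncrossing il jl' nij Qy Qy' C1 Qz'.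
  have := crossing_z_lt ij; have := crossing_z'_lt ij.
  by move: c hz hz' hy hy' m m'; rewrite -si -sj; circ.
(* Not crossing the chord on the left keeps [v1] from passing [z i], and so from passing [t]; in the
   gap 0 the bound is t^+ itself. The chord on the right bounds [v0] by [t'] in the same way. *)
have h1 : v1 = t \/ cyc3 (succ (rend j)) v1 t.
  have [[_ lE]|[i [jE il Qi si]]] := lendE jl.
    by move: c hsR; rewrite lE; move: (sep Zt Z1) (sep Zt ZsR) st tt'; circ.
  have [Qz Qz' hz hz'] := crossing_maxP il; have Zz := QZ Qz; have Zz' := QZ Qz'.
  have [iP _] := crossing_nth il.
  have nc1 : ~ cyc4 v1 (z' i) v0 (z i).
    move=> /(block_pts_noncrossing n_ge2 adm nc dec CP iP C1 C0 Qz' Qz).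
    exact: neq_left.
  have d1 : v1 <> z i.
    move=> v1E; apply: (neq_left i jE); rewrite v1E in C1.
    exact: (block_pts_disjoint n_ge2 adm nc dec CP iP C1 Qz).
  have hzz : succ (rend j) = z i \/ cyc3 t' (succ (rend j)) (z i).
    have [[_ rE]|[jl' Qj sj]] := rendE jl.
      by rewrite rE; move: (sep Zt' Zz) hz st' tst' tt'; circ.
    by right; rewrite sj; apply: crossing_z_lt; rewrite jl' jE ltnSn.
  by move: c nc1 d1 hz hz' hzz; rewrite -si; circ.
have h0 : v0 = t' \/ cyc3 (succ (lend j)) v0 t'.
  have [[_ rE]|[jl' Qj sj]] := rendE jl.
    by move: c hsL; rewrite rE; move: (sep Zt' Z0) (sep Zt' ZsL) st' tt'; circ.
  have [Qz Qz' hz hz'] := crossing_maxP jl'; have Zz := QZ Qz; have Zz' := QZ Qz'.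
  have [jP _] := crossing_nth jl'.
  have nc0 : ~ cyc4 v0 (z j) v1 (z' j).
    move=> /(block_pts_noncrossing n_ge2 adm nc dec CP jP C0 C1 Qz Qz').
    exact: neq_right.
  have d0 : v0 <> z' j.
    move=> v0E; apply: (neq_right jl'); rewrite v0E in C0.
    exact: (block_pts_disjoint n_ge2 adm nc dec CP jP C0 Qz').
  have hzz : succ (lend j) = z' j \/ cyc3 t (succ (lend j)) (z' j).
    have [[_ lE]|[i [jE il Qi si]]] := lendE jl.
      by rewrite lE; move: (sep Zt Zz') hz' st t'st tt'; circ.
    by right; rewrite si; apply: crossing_z'_lt; rewrite jl' jE ltnSn.
  by move: c nc0 d0 hz hz' hzz; rewrite -sj; circ.
have [k kl CE] : exists2 k, (k < size bs)%N & C = B k.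
  apply: (crossing_complete CP C0 C1).
  - by move: h0 hsL c (sep Zt Zt') tt' st t'st; circ.
  - by move: h1 hsR c (sep Zt' Zt) tt' st' tst'; circ.
  - by move: h0 hsL c (sep Zt Zt') t'st; circ.
  - by move: h1 hsR c (sep Zt' Zt) tst'; circ.
subst C; have [Qz Qz' hz hz'] := crossing_maxP kl; have Zz := QZ Qz; have Zz' := QZ Qz'.
have [_ _ m0 m0'] := crossing_max kl C0; have [m1 m1' _ _] := crossing_max kl C1.
(* [v0] lies beyond the successor of [lend j], hence so does the maximum [z' k], against the order
   of the z' when k < j; when k >= j the same comparison is made with [v1] and [z k]. *)
have [kj|jk] := ltnP k j.
  have [[j0 _]|[i [jE il Qi si]]] := lendE jl; first by rewrite j0 in kj.
  have ki : (k < i < size bs)%N.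
    rewrite il andbT ltn_neqAle -ltnS -jE kj andbT.
    by apply/eqP => ki; apply: (neq_left i jE); rewrite ki.
  have [_ Qy' _ _] := crossing_maxP il; have Zy' := QZ Qy'.
  have := crossing_z'_lt ki; rewrite -si.
  by move: h0 m0 m0' hsL hz' (sep Zt Zt') t'st tt'; circ.
have jl' : (j < size bs)%N := leq_ltn_trans jk kl.
have [[jE _]|[_ Qj sj]] := rendE jl; first by move: jl'; rewrite jE ltnn.
have jk' : (j < k < size bs)%N.
  rewrite kl andbT ltn_neqAle jk andbT.
  by apply/eqP => jkE; apply: (neq_right jl'); rewrite jkE.
have := crossing_z_lt jk'; rewrite -sj.
by move: h1 m1 m1' hsR hz (sep Zt' Zt) tst' tt'; circ.
Qed.

(** This provides a non-zero morphism from T to the arc. A successor of an end that reached [t'] or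
    [t] would make the pair trivial at an extreme gap, and violate the strict order of the cuts
    elsewhere. *)
Lemma coaisle_arc_cross_self j : (j <= size bs)%N ->
  is_arc Z [set lend j; rend j] -> cross t t' (succ (lend j)) (succ (rend j)).
Proof.
move=> jl LR_arc; have [ZL ZR LR RsL LsR] := (is_arcE adm _ _).1 LR_arc.
have [_ hL] := lend_in jl; have [_ hR] := rend_in jl.
have ZsL := succ_in adm ZL; have ZsR := succ_in adm ZR.
have cL : cyc3 t (succ (lend j)) t'.
  have [_ sn _] := succP adm ZL.
  have sLt' : succ (lend j) <> t'.
    have [[_ rE]|[jl' _ _]] := rendE jl; first by move=> sE; apply: RsL; rewrite sE.
    have [_ Qz' _ hz'] := crossing_maxP jl'; have Zz' := QZ Qz'.
    have [[_ ->]|[i [jE il _ ->]]] := lendE jl; first exact/nesym.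
    have [_ Qy' _ _] := crossing_maxP il; have Zy' := QZ Qy'.
    have ij : (i < j < size bs)%N by rewrite jl' jE ltnSn.
    by have := crossing_z'_lt ij; move: hz'; circ.
  by move: hL sLt' sn (sep ZL Zt) (sep ZL Zt') tt'; circ.
have cR : cyc3 t' (succ (rend j)) t.
  have [_ sn _] := succP adm ZR.
  have sRt : succ (rend j) <> t.
    have [[_ lE]|[i [jE il _ _]]] := lendE jl; first by move=> sE; apply: LsR; rewrite sE.
    have [Qz _ hz _] := crossing_maxP il; have Zz := QZ Qz.
    have [[_ ->]|[jl' _ ->]] := rendE jl; first exact/nesym.
    have [Qy _ _ _] := crossing_maxP jl'; have Zy := QZ Qy.
    have ij : (i < j < size bs)%N by rewrite jl' jE ltnSn.
    by have := crossing_z_lt ij; move: hz; circ.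
  by move: hR sRt sn (sep ZR Zt) (sep ZR Zt') tt'; circ.
by move: cL cR; circ.
Qed.

End Crossing.

(** * The approximation triangle of an arc *)

Section ArcMorphisms.
Variables (R : realType) (n : nat) (Z : set (R * R)) (a : 'I_n -> R * R).
Hypothesis adm : admissible Z a.
Variables (K : fieldType) (C : triangulated_category K) (ob : set (R * R) -> C).
Hypothesis dcc : discrete_cluster_category Z ob.
Local Notation succ := (succ_pt Z).

(** The crossing rule speaks of morphisms into a suspension. Writing an arc as the suspension of its
    shift to the successors turns it into a rule for Hom between arcs. *)
Lemma susp_succ w0 w1 : is_arc Z [set w0; w1] ->
  isomorphic (susp (ob [set succ w0; succ w1])) (ob [set w0; w1]).
Proof.
move=> w_arc; have [Z0 Z1 _ _ _] := (is_arcE adm _ _).1 w_arc.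
have := dcc_susp dcc (is_arc_succ adm w_arc).
by rewrite (succK adm Z0) (succK adm Z1).
Qed.

Lemma arc_mor0 p q w0 w1 : is_arc Z [set p; q] -> is_arc Z [set w0; w1] ->
  ~ cross p q (succ w0) (succ w1) ->
  forall f : mor (ob [set p; q]) (ob [set w0; w1]), f = 0.
Proof.
move=> pq_arc w_arc ncr f; have [r [s [sr rs]]] := susp_succ w_arc.
rewrite -[f]cmp1m -rs -cmpA.
by rewrite (dcc_hom_noncross dcc pq_arc (is_arc_succ adm w_arc) ncr (_ \oc f)) cmp0r.
Qed.

Lemma arc_mor_basis p q w0 w1 : is_arc Z [set p; q] -> is_arc Z [set w0; w1] ->
  cross p q (succ w0) (succ w1) ->
  exists2 f : mor (ob [set p; q]) (ob [set w0; w1]), f <> 0 &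
    forall g, exists c, g = c *: f.
Proof.
move=> pq_arc w_arc cr; have [r [s [sr rs]]] := susp_succ w_arc.
have [l [l' lK Kl]] := dcc_hom_cross dcc pq_arc (is_arc_succ adm w_arc) cr.
exists (r \oc l' 1) => [f0|g].
  have : l' 1 = 0 by rewrite -[l' 1]cmp1m -sr -cmpA f0 cmp0r.
  by move=> /(congr1 l); rewrite Kl linear0 => /eqP; rewrite oner_eq0.
exists (l (s \oc g)); rewrite -cmpZr.
have -> : l (s \oc g) *: l' 1 = s \oc g.
  by apply: (can_inj lK); rewrite linearZ /= Kl mulr1.
by rewrite cmpA rs cmp1m.
Qed.

Lemma arc_mor_scalar A W (f g : mor (ob A) (ob W)) : is_arc Z A -> is_arc Z W ->
  f <> 0 -> exists c, g = c *: f.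
Proof.
move=> A_arc W_arc f0.
have [p [q [_ AE]]] := A_arc; have [w0 [w1 [_ WE]]] := W_arc; subst A W.
have [cr|ncr] := pselect (cross p q (succ w0) (succ w1)); last first.
  by case: f0; exact: arc_mor0 ncr f.
have [b b0 bP] := arc_mor_basis A_arc W_arc cr.
have [c fE] := bP f; have [d gE] := bP g.
have c0 : c != 0 by apply/eqP => c0; apply: f0; rewrite fE c0 scale0r.
by exists (d / c); rewrite gE fE scalerA divfK.
Qed.

Lemma arc_mor_cross A W p q w0 w1 (f : mor (ob A) (ob W)) :
  is_arc Z A -> is_arc Z W -> A = [set p; q] -> W = [set w0; w1] -> f <> 0 ->
  cross p q (succ w0) (succ w1).
Proof.
move=> A_arc W_arc AE WE f0; subst A W; apply: contrapT => ncr.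
by apply: f0; exact: arc_mor0.
Qed.

Lemma arc_mor_factor A W S p q w0 w1 s0 s1 (f : mor (ob A) (ob W)) :
  is_arc Z A -> is_arc Z W -> is_arc Z S ->
  A = [set p; q] -> W = [set w0; w1] -> S = [set s0; s1] ->
  cyc4 p (succ w0) q (succ w1) -> Icc Z p w0 s0 -> Icc Z q w1 s1 -> f <> 0 ->
  exists (g : mor (ob A) (ob S)) (h : mor (ob S) (ob W)), f = h \oc g.
Proof.
move=> A_arc W_arc S_arc AE WE SE c I0 I1 f0; subst A W.
by apply/(dcc_factor dcc A_arc W_arc c f0 S_arc); exists s0, s1.
Qed.

Lemma cyc4_succ p q : is_arc Z [set p; q] -> cyc4 p (succ p) q (succ q).
Proof.
move=> /(is_arcE adm)[Zp Zq pq qsp psq].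
have Zsp := succ_in adm Zp; have Zsq := succ_in adm Zq.
have [_ np sp] := succP adm Zp; have [_ nq sq] := succP adm Zq.
by move: (sp q Zq) (sq p Zp) pq qsp psq np nq; circ.
Qed.

End ArcMorphisms.

(** Trivial pairs are left out of [T|_X] and [T|_Y], so the summands are indexed by an enumeration
    of those positions that give arcs. *)
Lemma enumerate_below (m : nat) (D : nat -> Prop) :
  exists k (e : 'I_k -> nat), [/\ injective e, forall i, (e i < m)%N /\ D (e i)
    & forall j, (j < m)%N -> D j -> exists i, e i = j].
Proof.
pose r := [seq j <- iota 0 m | `[< D j >]].
have rP j : j \in r = (j < m)%N && `[< D j >] by rewrite mem_filter mem_iota andbC.
exists (size r), (fun i => nth 0%N r i); split=> [i j /eqP|i|j jm Dj].
- by rewrite nth_uniq ?filter_uniq ?iota_uniq // => /eqP/val_inj.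
- by have := mem_nth 0%N (ltn_ord i); rewrite rP => /andP[? /asboolP].
have /(nthP 0%N)[i ir <-] : j \in r by rewrite rP jm; apply/asboolP.
by exists (Ordinal ir).
Qed.

Section Approximation.
Variables (R : realType) (n : nat) (Z : set (R * R)) (a : 'I_n -> R * R).
Hypothesis n_ge2 : (2 <= n)%N.
Hypothesis adm : admissible Z a.
Variables (K : fieldType) (C : triangulated_category K) (ob : set (R * R) -> C).
Hypothesis dcc : discrete_cluster_category Z ob.
Variables (X Y : set C) (P : {set {set 'I_n}}) (x : 'I_n -> R * R).
Hypothesis XY : t_structure X Y.
Hypothesis nc : noncrossing_partition P.
Hypothesis dec : decoration Z a P x.
Hypothesis XE : X = aisle_of Z ob a P x.
Variables (t t' : R * R) (bs : seq {set 'I_n}).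
Hypothesis T_arc : is_arc Z [set t; t'].
Hypothesis bsP : crossing_blocks Z a P x t t' bs.
Variables (M W : C) (f : mor M (ob [set t; t'])) (g : mor (ob [set t; t']) W)
  (h : mor W (susp M)).
Hypothesis fgh : approximation_triangle X Y f g h.
Local Notation T := (ob [set t; t']).
Local Notation succ := (succ_pt Z).
Local Notation z := (block_cut Z a x t bs).
Local Notation z' := (block_cut Z a x t' bs).
Local Notation lend := (left_end Z a x t t' bs).
Local Notation rend := (right_end Z a x t t' bs).

Let block_arcs : set C := [set S | exists (B : {set 'I_n}) (y0 y1 : R * R),
  [/\ B \in P, is_arc Z [set y0; y1], block_pts Z a x B y0,
      block_pts Z a x B y1 & S = ob [set y0; y1]]].

Let XG : X = add_generated block_arcs.
Proof.
rewrite XE /aisle_of; congr add_generated; apply/seteqP.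
split=> S [B [y0 [y1 [BP y_arc B0 B1 ->]]]]; exists B, y0, y1; split=> //.
- by split=> //; case/(is_arcE adm): y_arc.
- by split=> //; case/(is_arcE adm): y_arc.
- by case: B0.
- by case: B1.
Qed.

Let C_additive : additive_category C := triangulated_additive C.

Lemma aisle_sum_of_arcs : sum_of_arcs ob (arcs_X Z a x t t' bs) M.
Proof.
have [m [e [e_inj eP e_surj]]] :=
  enumerate_below (size bs) (fun j => is_arc Z [set z' j; z j]).
pose s k := [set z' (e k); z (e k)].
have e_lt k : (e k < size bs)%N := (eP k).1.
have s_arc k : is_arc Z (s k) := (eP k).2.
have maxP := crossing_maxP n_ge2 adm nc dec T_arc bsP.
have bs_nth j : (j < size bs)%N -> nth finset.set0 bs j \in P.
  by move=> jl; case: (crossing_nth adm T_arc bsP jl).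
have unique := aisle_arc_unique n_ge2 adm nc dec T_arc bsP.
have s_mor k B y0 y1 (v : mor (ob [set y0; y1]) (ob (s k))) : B \in P ->
    is_arc Z [set y0; y1] -> block_pts Z a x B y0 -> block_pts Z a x B y1 ->
    v <> 0 -> B = nth finset.set0 bs (e k) /\ cross y0 y1 (succ t) (succ t').
  move=> BP y_arc B0 B1 v0.
  have [c|c] := arc_mor_cross adm dcc y_arc (s_arc k) erefl erefl v0.
    by have [-> ?] := unique _ _ _ _ BP B0 B1 (e_lt k) c; split=> //; right.
  have c' : cyc4 y1 (succ (z' (e k))) y0 (succ (z (e k))) by case: c.
  have [-> [? ? ? ?]] := unique _ _ _ _ BP B1 B0 (e_lt k) c'.
  by split=> //; left.
have T_factor B y0 y1 (u : mor (ob [set y0; y1]) T) : B \in P ->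
    is_arc Z [set y0; y1] -> block_pts Z a x B y0 -> block_pts Z a x B y1 ->
    u <> 0 -> exists k (v : mor (ob [set y0; y1]) (ob (s k))) (w : mor (ob (s k)) T),
      u = w \oc v.
  have factor q0 q1 (v : mor (ob [set y0; y1]) T) : B \in P ->
      is_arc Z [set y0; y1] -> [set y0; y1] = [set q0; q1] ->
      block_pts Z a x B q0 -> block_pts Z a x B q1 -> v <> 0 ->
      cyc4 q0 (succ t') q1 (succ t) ->
      exists k (v' : mor (ob [set y0; y1]) (ob (s k))) (w : mor (ob (s k)) T),
      v = w \oc v'.
    move=> BP y_arc yq B0 B1 v0 c.
    have [j [jl j_arc I0 I1]] := aisle_arc_factors n_ge2 adm nc dec T_arc bsP BP B0 B1 c.
    have [k kj] := e_surj j jl j_arc; exists k; rewrite -kj in I0 I1.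
    exact: (arc_mor_factor dcc y_arc T_arc (s_arc k) yq (setUC _ _) erefl c I0 I1 v0).
  move=> BP y_arc B0 B1 u0.
  have [c|c] := arc_mor_cross adm dcc y_arc T_arc erefl erefl u0; last first.
    exact: factor c.
  by apply: (factor y1 y0) => //; [rewrite setUC|case: c].
have T_mor k : exists u : mor (ob (s k)) T, u <> 0.
  have [Qz Qz' _ _] := maxP _ (e_lt k).
  have := unique _ _ _ _ (bs_nth _ (e_lt k)) Qz' Qz (e_lt k) (cyc4_succ adm (s_arc k)).
  move=> [_ c].
  by have [u u0 _] := arc_mor_basis adm dcc (s_arc k) T_arc (or_intror c); exists u.
pose phi k := sval (cid (T_mor k)).
have phi0 k : phi k <> 0 := svalP (cid (T_mor k)).
exists m, s; split.
- move=> k k' skk'; apply: e_inj; apply: (crossing_inj bsP) => //.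
  have [Qz Qz' _ _] := maxP _ (e_lt k); have [Qy Qy' _ _] := maxP _ (e_lt k').
  (* The point [z (e k)] is an end of both equal arcs, hence a point of both blocks. *)
  apply: (block_pts_disjoint n_ge2 adm nc dec (bs_nth _ (e_lt k)) (bs_nth _ (e_lt k')) Qz).
  have : s k (z (e k)) by right.
  by rewrite skk' => -[->|->].
- apply/seteqP; split=> [A [k _ <-]|A [A_arc [j jl AE]]].
    by split=> //; exists (e k).
  rewrite -/(z j) -/(z' j) in AE.
  have [|k kj] := e_surj j jl; first by rewrite -AE.
  by exists k => //; rewrite /s kj.
have [XM YW _] := fgh.
apply: (coreflection_direct_sum C_additive (G := block_arcs) (phi := phi) (f := f)).
- move=> k; apply: sub_add_generated => /=.
  have [Qz Qz' _ _] := maxP _ (e_lt k).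
  exists (nth finset.set0 bs (e k)), (z' (e k)), (z (e k)); split=> //.
    exact: bs_nth.
  exact: s_arc.
- move=> A u [B [y0 [y1 [BP y_arc B0 B1 AE]]]]; subst A.
  have [->|u0] := pselect (u = 0); [by left|right].
  have [k [v [w uE]]] := T_factor B y0 y1 u BP y_arc B0 B1 u0.
  have [c wE] := arc_mor_scalar adm dcc w (s_arc k) T_arc (phi0 k).
  by exists k, (c *: v); rewrite uE wE cmpZl cmpZr.
- move=> A k l v w [B [y0 [y1 [BP y_arc B0 B1 AE]]]] kl; subst A.
  have [->|v0] := pselect (v = 0); [by left|right].
  apply: contrapT => w0; apply: kl; apply: e_inj; apply: (crossing_inj bsP) => //.
  have [<- _] := s_mor k _ _ _ v BP y_arc B0 B1 v0.
  by have [<- _] := s_mor l _ _ _ w BP y_arc B0 B1 w0.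
- move=> A k v [B [y0 [y1 [BP y_arc B0 B1 AE]]]] phiv; subst A.
  apply: contrapT => v0.
  have [kB c] := s_mor k _ _ _ v BP y_arc B0 B1 v0.
  (* A non-zero morphism to T exists and factors through some summand, necessarily the k-th. Its two
     factors are multiples of [v] and [phi k], so it would vanish with their composite. *)
  have [u u0 _] := arc_mor_basis adm dcc y_arc T_arc c.
  have [l [w [w' uE]]] := T_factor B y0 y1 u BP y_arc B0 B1 u0.
  have w0 : w <> 0 by move=> w0; apply: u0; rewrite uE w0 cmp0r.
  have [lB _] := s_mor l _ _ _ w BP y_arc B0 B1 w0.
  have lk : l = k by apply: e_inj; apply: (crossing_inj bsP) => //; rewrite -kB -lB.
  subst l; have [d wE] := arc_mor_scalar adm dcc w y_arc (s_arc k) v0.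
  have [d' w'E] := arc_mor_scalar adm dcc w' (s_arc k) T_arc (phi0 k).
  by apply: u0; rewrite uE wE w'E cmpZl cmpZr phiv !scaler0.
- by rewrite -XG.
- by move=> A u; rewrite -XG; move=> XA; exact: (approximation_lift XY fgh u XA).
- by move=> A v; rewrite -XG; move=> XA; exact: (approximation_lift_inj XY fgh XA).
Qed.

Let arcs : set C := [set S | exists2 D, is_arc Z D & S = ob D].

Let YG : Y = add_generated (arcs `&` Y).
Proof.
apply: (coaisle_generated XY); first exact: dcc_krull_schmidt dcc.
move=> S /(dcc_surj dcc)[D D_arc SD]; exists (ob D) => //.
by exists D.
Qed.

Let coaisle_uncrossed d0 d1 : is_arc Z [set d0; d1] -> Y (ob [set d0; d1]) ->
  uncrossed Z a P x (succ d0) (succ d1).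
Proof.
move=> d_arc Yd B v0 v1 BP B0 B1 c; have [Z0 Z1 _ _ _] := (is_arcE adm _ _).1 d_arc.
have v_arc : is_arc Z [set v0; v1].
  apply: (cross_is_arc adm _ _ _ _ c); [by case: B0|by case: B1| |];
    exact: (succ_in adm).
have [u u0 _] := arc_mor_basis adm dcc v_arc d_arc c.
apply: u0; apply: (t_structure_hom0 XY) => //.
by rewrite XG; apply: sub_add_generated; exists B, v0, v1.
Qed.

Let uncrossed_coaisle d0 d1 : is_arc Z [set d0; d1] ->
  uncrossed Z a P x (succ d0) (succ d1) -> Y (ob [set d0; d1]).
Proof.
move=> d_arc unc; apply: (coaisle_perp XY) => A u XA.
pose perp : set C := [set A | forall u : mor A (ob [set d0; d1]), u = 0].
suff : perp A by exact.
move: XA; rewrite XG; apply.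
  split=> [A0 A00 v|A' B S iA iB pA pB [piA piB _ _ ip]]; first exact: is_zero_src.
  split=> [S0|[A0 B0] v].
    split=> v; [rewrite -[v]cmpm1 -piA|rewrite -[v]cmpm1 -piB];
      by rewrite cmpA (S0 (v \oc _)) cmp0l.
  by rewrite -[v]cmpm1 -ip cmpDr !cmpA (A0 (v \oc iA)) (B0 (v \oc iB)) !cmp0l addr0.
move=> _ [B [y0 [y1 [BP y_arc B0 B1 ->]]]] v.
by apply: (arc_mor0 adm dcc y_arc d_arc); exact: (unc B y0 y1 BP B0 B1).
Qed.

Lemma arcs_YE A : arcs_Y Z a x t t' bs A <->
  is_arc Z A /\ exists2 j, (j <= size bs)%N & A = [set lend j; rend j].
Proof.
rewrite /arcs_Y /right_end; case: (size bs) => [|l].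
  split=> [->|[_ [[|//] _ ->]]] //.
  by split=> //; exists 0%N.
split=> [[A_arc AE]|[A_arc [j jl AE]]]; split=> //.
  case: AE => [->|->|[i il ->]].
  - by exists 0%N.
  - by exists l.+1; rewrite // ltnn.
  - by exists i.+1; [exact: ltnW|rewrite ltnS il].
case: j jl AE => [_ ->|i]; first by constructor 1.
rewrite ltnS leq_eqVlt => /orP[/eqP ->|il ->].
  by rewrite ltnn => ->; constructor 2.
by rewrite ltnS il; constructor 3; exists i.
Qed.

Lemma coaisle_sum_of_arcs : sum_of_arcs ob (arcs_Y Z a x t t' bs) W.
Proof.
have [m [e [e_inj eP e_surj]]] :=
  (* The l crossing chords leave l + 1 gaps, including the two at the ends of T. *)
  enumerate_below (size bs).+1 (fun j => is_arc Z [set lend j; rend j]).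
pose s k := [set lend (e k); rend (e k)].
have e_le k : (e k <= size bs)%N := (eP k).1.
have s_arc k : is_arc Z (s k) := (eP k).2.
have s_unc k := coaisle_arc_uncrossed n_ge2 adm nc dec T_arc bsP (e_le k) (s_arc k).
have YF k : Y (ob (s k)) by apply: uncrossed_coaisle; [exact: s_arc|exact: s_unc].
have s_mor k d0 d1 (v : mor (ob (s k)) (ob [set d0; d1])) :
    is_arc Z [set d0; d1] -> v <> 0 ->
    cross (lend (e k)) (rend (e k)) (succ d0) (succ d1).
  by move=> d_arc v0; exact: (arc_mor_cross adm dcc (s_arc k) d_arc erefl erefl v0).
have s_unique k l d0 d1 (v : mor (ob (s k)) (ob [set d0; d1]))
    (w : mor (ob (s l)) (ob [set d0; d1])) :
    is_arc Z [set d0; d1] -> Y (ob [set d0; d1]) -> v <> 0 -> w <> 0 -> k = l.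
  move=> d_arc Yd v0 w0; apply: e_inj.
  have unc := coaisle_uncrossed d_arc Yd.
  apply: (coaisle_arc_unique n_ge2 adm nc dec T_arc bsP (e_le k) (e_le l)
    (is_arc_succ adm d_arc) unc); [exact: s_mor v0|exact: s_mor w0].
have T_factor d0 d1 (u : mor T (ob [set d0; d1])) :
    is_arc Z [set d0; d1] -> Y (ob [set d0; d1]) -> u <> 0 ->
    exists k (v : mor T (ob (s k))) (w : mor (ob (s k)) (ob [set d0; d1])),
      u = w \oc v.
  have factor q0 q1 (v : mor T (ob [set d0; d1])) : is_arc Z [set d0; d1] ->
      [set d0; d1] = [set q0; q1] -> Y (ob [set q0; q1]) -> v <> 0 ->
      cyc4 t (succ q0) t' (succ q1) ->
      exists k (v' : mor T (ob (s k))) (w : mor (ob (s k)) (ob [set d0; d1])),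
      v = w \oc v'.
    move=> d_arc dq Yq v0 c; have q_arc : is_arc Z [set q0; q1] by rewrite -dq.
    have [j [jl j_arc I0 I1]] := coaisle_arc_factors n_ge2 adm nc dec T_arc bsP
      q_arc (coaisle_uncrossed q_arc Yq) c.
    have [k kj] := e_surj j jl j_arc; exists k; rewrite -kj in I0 I1.
    exact: (arc_mor_factor dcc T_arc d_arc (s_arc k) erefl dq erefl c I0 I1 v0).
  move=> d_arc Yd u0.
  have [c|c] := arc_mor_cross adm dcc T_arc d_arc erefl erefl u0.
    exact: factor c.
  by apply: (factor d1 d0) => //; rewrite setUC.
have T_mor k : exists u : mor T (ob (s k)), u <> 0.
  have [u u0 _] := arc_mor_basis adm dcc T_arc (s_arc k)
    (coaisle_arc_cross_self n_ge2 adm nc dec T_arc bsP (e_le k) (s_arc k)).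
  by exists u.
pose psi k := sval (cid (T_mor k)).
have psi0 k : psi k <> 0 := svalP (cid (T_mor k)).
have id_neq0 k : idm (ob (s k)) <> 0 by case: (dcc_indecomposable dcc (s_arc k)).
exists m, s; split.
- have inj k k' : s k = s k' -> k = k'.
    move=> skk'; have id' : exists v : mor (ob (s k')) (ob (s k)), v <> 0.
      by rewrite -skk'; exists (idm (ob (s k))).
    by have [v v0] := id'; exact: (s_unique k k' _ _ _ v (s_arc k) (YF k) (id_neq0 k) v0).
  exact: inj.
- apply/seteqP; split=> [A [k _ <-]|A /arcs_YE[A_arc [j jl AE]]].
    by apply/arcs_YE; split; [exact: s_arc|exists (e k) => //; exact: e_le].
  have [|k kj] := e_surj j jl; first by rewrite -AE.
  by exists k => //; rewrite /s kj.
have [XM YW _] := fgh.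
apply: (reflection_direct_sum C_additive (G := arcs `&` Y) (psi := psi) (g := g)).
- by move=> k; rewrite -YG.
- move=> A u [[D D_arc AE] YD]; subst A; have [d0 [d1 [_ DE]]] := D_arc; subst D.
  have [->|u0] := pselect (u = 0); [by left|right].
  have [k [v [w uE]]] := T_factor d0 d1 u D_arc YD u0.
  have [c vE] := arc_mor_scalar adm dcc v T_arc (s_arc k) (psi0 k).
  by exists k, (c *: w); rewrite uE vE cmpZl cmpZr.
- move=> A k l v w [[D D_arc AE] YD] kl; subst A.
  have [d0 [d1 [_ DE]]] := D_arc; subst D.
  have [->|v0] := pselect (v = 0); [by left|right].
  by apply: contrapT => w0; apply: kl; exact: (s_unique k l _ _ v w D_arc YD v0 w0).
- move=> A k v [[D D_arc AE] YD] vpsi; subst A.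
  have [d0 [d1 [_ DE]]] := D_arc; subst D.
  apply: contrapT => v0; have c := s_mor k _ _ v D_arc v0.
  (* Since [D] also receives a non-zero morphism from T, the argument used for the aisle applies
     with the arrows reversed. *)
  have {}c := coaisle_arc_cross n_ge2 adm nc dec T_arc bsP (e_le k)
    (is_arc_succ adm D_arc) (coaisle_uncrossed D_arc YD) c.
  have [u u0 _] := arc_mor_basis adm dcc T_arc D_arc c.
  have [l [w' [w uE]]] := T_factor d0 d1 u D_arc YD u0.
  have w0 : w <> 0 by move=> w0; apply: u0; rewrite uE w0 cmp0l.
  have kl := s_unique k l _ _ v w D_arc YD v0 w0; subst l.
  have [d wE] := arc_mor_scalar adm dcc w (s_arc k) D_arc v0.
  have [d' w'E] := arc_mor_scalar adm dcc w' T_arc (s_arc k) (psi0 k).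
  by apply: u0; rewrite uE wE w'E cmpZl cmpZr vpsi !scaler0.
- by rewrite -YG.
- by move=> A u; rewrite -YG => YA; exact: (approximation_extend XY fgh u YA).
- by move=> A v; rewrite -YG => YA; exact: (approximation_extend_inj XY fgh YA).
Qed.

End Approximation.

Local Close Scope cat_scope.
Local Close Scope ring_scope.

Theorem corollary4p17 (R : realType) (K : fieldType) (n : nat)
    (Z : set (R * R)) (a : 'I_n -> R * R)
    (C : triangulated_category K) (ob : set (R * R) -> C)
    (X Y : set C) (P : {set {set 'I_n}}) (x : 'I_n -> R * R)
    (t t' : R * R) (bs : seq {set 'I_n}) :
  2 <= n ->
  admissible Z a ->
  discrete_cluster_category Z ob ->
  t_structure X Y ->
  noncrossing_partition P ->
  decoration Z a P x ->
  X = aisle_of Z ob a P x ->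
  is_arc Z [set t; t'] ->
  crossing_blocks Z a P x t t' bs ->
  forall (M W : C) (f : mor M (ob [set t; t'])) (g : mor (ob [set t; t']) W)
    (h : mor W (susp M)),
    approximation_triangle X Y f g h ->
    sum_of_arcs ob (arcs_X Z a x t t' bs) M /\
    sum_of_arcs ob (arcs_Y Z a x t t' bs) W.
Proof.
move=> n_ge2 adm dcc XY nc dec XE T_arc bsP M W f g h fgh; split.
  exact: (aisle_sum_of_arcs n_ge2 adm dcc XY nc dec XE T_arc bsP fgh).
exact: (coaisle_sum_of_arcs n_ge2 adm dcc XY nc dec XE T_arc bsP fgh).
Qed.
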